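(* Let $S$ be a commutative noetherian ring and let $x_1,\dots,x_n\in S$ be non-zerodivisors. Then $$\operatorname{radius}(\mathsf{MF}(x_1)\ast\cdots\ast\mathsf{MF}(x_n))\le\sup\{\dim\mathsf{MF}(x_1),\dots,\dim\mathsf{MF}(x_n)\}+1.$$ Here $\dim\mathsf{MF}(x_i)$ is taken for $\mathsf{MF}(x_i)$ as a subcategory of $\mathsf{mod}\,S/(x_i)$, and the radius on the left is taken for $\mathsf{MF}(x_1)\ast\cdots\ast\mathsf{MF}(x_n)$ as a subcategory of $\mathsf{mod}\,S/(x_1\cdots x_n)$.
   Context: All rings are commutative noetherian, all modules are finitely generated, all subcategories are full; $\mathsf{mod}\,R$ is the category of finitely generated $R$-modules. For $x\in S$, $\mathsf{MF}(x)$ is the full subcategory of $\mathsf{mod}\,S$ consisting of modules $M$ with $xM=0$ admitting an exact sequence of $S$-modules $0\to S^a\to S^b\to M\to0$ for some integers $a,b\ge0$; it is regarded as a full subcategory of $\mathsf{mod}\,S/(x)$. For ideals $I,J$ of $S$ and full subcategories $\mathcal X\subseteq\mathsf{mod}\,S/I$, $\mathcal Y\subseteq\mathsf{mod}\,S/J$, $\mathcal X\ast\mathcal Y$ is the full subcategory of $\mathsf{mod}\,S/IJ$ consisting of modules $M$ admitting an exact sequence $0\to X\to M\to Y\to0$ with $X\in\mathcal X$, $Y\in\mathcal Y$. This operation is associative, so iterated expressions need no parentheses. Let $R$ be a commutative noetherian ring and $\mathcal X,\mathcal Y$ subcategories of $\mathsf{mod}\,R$. For an $R$-module $M$ and $i\ge0$,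 $\Omega^iM$ is the $i$th syzygy of $M$, i.e. the image of the $i$th differential in a resolution of $M$ by finitely generated projective modules ($\Omega^0M=M$), unique up to projective summands. The additive closure of $\mathcal X$ consists of direct summands of finite direct sums of objects of $\mathcal X$. $[\mathcal X]$ denotes the additive closure of the subcategory consisting of $R$ and all modules $\Omega^iX$ with $i\ge0$, $X\in\mathcal X$. $\mathcal X\circ\mathcal Y$ is the subcategory of $R$-modules $E$ appearing in an exact sequence $0\to X\to E\to Y\to0$ with $X\in\mathcal X$, $Y\in\mathcal Y$. Put $[\mathcal X]_1=[\mathcal X]$ and $[\mathcal X]_r=[[\mathcal X]_{r-1}\circ[\mathcal X]]$ for $r\ge2$, and $[G]_r=[\{G\}]_r$ for a module $G$. The dimension $\dim\mathcal X$ (resp. radius, $\operatorname{radius}\mathcal X$) of a subcategory $\mathcal X$ of $\mathsf{mod}\,R$ is the infimum of the integers $n\ge0$ such that $\mathcal X=[G]_{n+1}$ (resp. $\mathcal X\subseteq[G]_{n+1}$) for some $G\in\mathsf{mod}\,R$; it is $\infty$ if no such $n$ exists. *)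

(* Defs.v *)
From HB Require Import structures.
From mathcomp Require Import all_boot all_order all_algebra.
From mathcomp Require Import boolp classical_sets constructive_ereal ereal.

Set Implicit Arguments.
Unset Strict Implicit.
Unset Printing Implicit Defensive.

Import Order.TTheory GRing.Theory Num.Theory.
Local Open Scope ring_scope.

(* Rings are [comPzRingType]: the zero ring is allowed, since S/(x) is zero
   when the non-zerodivisor x is a unit. *)

Definition is_ideal (R : comPzRingType) (I : set R) : Prop :=
  [/\ I 0, forall a b, I a -> I b -> I (a + b)
         & forall s a, I a -> I (s * a)].

Definition noetherian (R : comPzRingType) : Prop :=
  forall I : set R, is_ideal I ->
    exists (n : nat) (g : 'I_n -> R),
      forall a, I a <-> exists c : 'I_n -> R, a = \sum_i c i * g i.

(* The quotient ring S/(x).  The quotients of [ring_quotient] only provide a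
   ring structure for proper ideals, but already the additive group for any
   [zmodClosed] predicate; the multiplication is added here. *)
Section QuotientRing.
Variables (S : comPzRingType) (x : S).

Definition pideal : {pred S} := fun y => `[< exists s, y = s * x >].

Lemma pidealP y : reflect (exists s, y = s * x) (y \in pideal).
Proof. exact: asboolP. Qed.

Fact pideal_zmod_closed : zmod_closed pideal.
Proof.
split; first by apply/pidealP; exists 0; rewrite mul0r.
move=> _ _ /pidealP[s ->] /pidealP[t ->].
by apply/pidealP; exists (s - t); rewrite mulrBl.
Qed.
HB.instance Definition _ := GRing.isZmodClosed.Build S pideal pideal_zmod_closed.

Definition quotr : Type := Quotient.quot pideal.
HB.instance Definition _ := GRing.Zmodule.on quotr.

Definition quotr_pi (s : S) : quotr := (\pi_(Quotient.quot pideal) s)%qT.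
Definition quotr_mul (a b : quotr) : quotr :=
  quotr_pi (repr (a : Quotient.quot pideal) * repr (b : Quotient.quot pideal)).

Lemma quotr_pi_eq s t : quotr_pi s = quotr_pi t <-> exists u, s - t = u * x.
Proof.
split; last by move=> h; apply/eqP; rewrite -Quotient.idealrBE; apply/pidealP.
by move/eqP; rewrite -Quotient.idealrBE => /pidealP.
Qed.

Lemma quotr_pi_surj (a : quotr) : exists s, quotr_pi s = a.
Proof. by exists (repr (a : Quotient.quot pideal)); rewrite /quotr_pi reprK. Qed.

Lemma quotr_piM s t : quotr_pi (s * t) = quotr_mul (quotr_pi s) (quotr_pi t).
Proof.
rewrite /quotr_mul; set s' := repr _; set t' := repr _; apply/quotr_pi_eq.
have /quotr_pi_eq[u eu] : quotr_pi s = quotr_pi s' by rewrite /quotr_pi reprK.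
have /quotr_pi_eq[v ev] : quotr_pi t = quotr_pi t' by rewrite /quotr_pi reprK.
exists (u * t + s' * v); rewrite mulrDl -mulrA [t * x]mulrC mulrA -eu -mulrA -ev.
by rewrite mulrBl mulrBr addrA subrK.
Qed.

Fact quotr_mulA : associative quotr_mul.
Proof.
move=> a b c; case: (quotr_pi_surj a) (quotr_pi_surj b) (quotr_pi_surj c).
by move=> s <- [t <-] [u <-]; rewrite -!quotr_piM mulrA.
Qed.
Fact quotr_mulC : commutative quotr_mul.
Proof.
move=> a b; case: (quotr_pi_surj a) (quotr_pi_surj b).
by move=> s <- [t <-]; rewrite -!quotr_piM mulrC.
Qed.
Fact quotr_mul1 : left_id (quotr_pi 1) quotr_mul.
Proof.
by move=> a; case: (quotr_pi_surj a) => s <-; rewrite -quotr_piM mul1r.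
Qed.
Fact quotr_piD s t : quotr_pi (s + t) = quotr_pi s + quotr_pi t.
Proof. by rewrite /quotr_pi piE. Qed.
Fact quotr_mulDl : left_distributive quotr_mul +%R.
Proof.
move=> a b c; case: (quotr_pi_surj a) (quotr_pi_surj b) (quotr_pi_surj c).
by move=> s <- [t <-] [u <-]; rewrite -quotr_piD -!quotr_piM -quotr_piD mulrDl.
Qed.
HB.instance Definition _ := GRing.Zmodule_isComPzRing.Build quotr
  quotr_mulA quotr_mulC quotr_mul1 quotr_mulDl.

Fact quotr_pi_zmod_morphism : zmod_morphism quotr_pi.
Proof.
by move=> s t; apply: (addIr (quotr_pi t)); rewrite subrK -quotr_piD subrK.
Qed.
Fact quotr_pi_monoid_morphism : monoid_morphism quotr_pi.
Proof. by split=> // s t; rewrite quotr_piM. Qed.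
HB.instance Definition _ :=
  GRing.isZmodMorphism.Build S quotr quotr_pi quotr_pi_zmod_morphism.
HB.instance Definition _ :=
  GRing.isMonoidMorphism.Build S quotr quotr_pi quotr_pi_monoid_morphism.
End QuotientRing.

Definition restr (S R : pzRingType) (f : {rmorphism S -> R})
  (M : lmodType R) : Type := M.

Section RestrictionOfScalars.
Variables (S R : pzRingType) (f : {rmorphism S -> R}) (M : lmodType R).

HB.instance Definition _ := GRing.Zmodule.on (restr f M).

Definition restr_scale (s : S) (m : restr f M) : restr f M := f s *: (m : M).

Fact restr_scaleA s t m :
  restr_scale s (restr_scale t m) = restr_scale (s * t) m.
Proof. by rewrite /restr_scale scalerA rmorphM. Qed.
Fact restr_scale1 : left_id 1 restr_scale.
Proof. by move=> m; rewrite /restr_scale rmorph1 scale1r. Qed.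
Fact restr_scaleDr : right_distributive restr_scale +%R.
Proof. by move=> s m m'; rewrite /restr_scale scalerDr. Qed.
Fact restr_scaleDl m : {morph restr_scale^~ m : s t / s + t}.
Proof. by move=> s t; rewrite /restr_scale rmorphD scalerDl. Qed.
HB.instance Definition _ := GRing.Zmodule_isLmodule.Build S (restr f M)
  restr_scaleA restr_scale1 restr_scaleDr restr_scaleDl.
End RestrictionOfScalars.

(* A full subcategory of mod R, given by its class of objects.  All the
   subcategories below consist of finitely generated modules and are closed
   under isomorphism. *)
Definition subcat (R : pzRingType) := lmodType R -> Prop.

Section Modules.
Variable R : pzRingType.
Implicit Types (M N P E : lmodType R) (X Y : subcat R).

Definition fin_gen M : Prop :=
  exists (n : nat) (g : 'I_n -> M),
    forall m, exists c : 'I_n -> R, m = \sum_i c i *: g i.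

Definition isom M N : Prop := exists f : {linear M -> N}, bijective f.

Definition surj (A B : Type) (f : A -> B) : Prop := forall b, exists a, f a = b.

Definition exact_at (A B C : lmodType R) (f : A -> B) (g : B -> C) : Prop :=
  forall b, g b = 0 <-> exists a, f a = b.

Definition short_exact (A B C : lmodType R) (f : A -> B) (g : B -> C) : Prop :=
  [/\ injective f, exact_at f g & surj g].

Definition projective P : Prop :=
  forall (M N : lmodType R) (g : {linear M -> N}) (f : {linear P -> N}),
    surj g -> exists h : {linear P -> M}, forall p, g (h p) = f p.

Record proj_resolution M := ProjResolution {
  pr_mod :> nat -> lmodType R;
  pr_diff : forall i, {linear pr_mod i.+1 -> pr_mod i};
  pr_aug : {linear pr_mod 0%N -> M};
  pr_fin_gen : forall i, fin_gen (pr_mod i);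
  pr_projective : forall i, projective (pr_mod i);
  pr_aug_surj : surj pr_aug;
  pr_exact0 : exact_at (pr_diff 0) pr_aug;
  pr_exactS : forall i, exact_at (pr_diff i.+1) (pr_diff i)
}.

(* [is_syzygy i M N]: N is (isomorphic to) an i-th syzygy of M, namely M itself
   for i = 0 and the image of P_i -> P_(i-1) in some resolution otherwise. *)
Definition is_syzygy (i : nat) M N : Prop :=
  match i with
  | 0 => isom N M
  | j.+1 => exists (P : proj_resolution M) (h : {linear N -> P j}),
      injective h /\ range h = range (pr_diff P j)
  end.

Definition direct_sum (s : seq (lmodType R)) : lmodType R :=
  foldr (fun M N => (M * N)%type : lmodType R) ('rV[R]_0 : lmodType R) s.

Fixpoint all_in X (s : seq (lmodType R)) : Prop :=
  if s is M :: s' then X M /\ all_in X s' else True.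

Definition add_closure X : subcat R := fun M =>
  exists s : seq (lmodType R), all_in X s /\
    exists N : lmodType R, isom (M * N)%type (direct_sum s).

Definition bracket X : subcat R :=
  add_closure (fun M => isom M R^o \/
    exists (i : nat) (N : lmodType R), X N /\ is_syzygy i N M).

Definition extensions X Y : subcat R := fun E =>
  exists (M N : lmodType R) (f : {linear M -> E}) (g : {linear E -> N}),
    [/\ X M, Y N & short_exact f g].

(* [bracketS X n] is [X]_(n+1). *)
Fixpoint bracketS X (n : nat) : subcat R :=
  match n with
  | 0 => bracket X
  | n'.+1 => bracket (extensions (bracketS X n') (bracket X))
  end.

Definition sing M : subcat R := fun N => isom N M.

(* Values in {0, 1, 2, ...} with +oo (the infimum of the empty set).  [\bar rat]
   is only a carrier for the order and for [ereal_inf]: a nonempty set of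
   naturals attains its infimum. *)
Definition subcat_dim X : \bar rat :=
  ereal_inf [set (n%:R : rat)%:E | n in [set n : nat |
    exists G : lmodType R, fin_gen G /\
      forall M, X M <-> bracketS (sing G) n M]].

Definition subcat_radius X : \bar rat :=
  ereal_inf [set (n%:R : rat)%:E | n in [set n : nat |
    exists G : lmodType R, fin_gen G /\
      forall M, X M -> bracketS (sing G) n M]].
End Modules.

Section MatrixFactorizations.
Variable S : comPzRingType.

Definition MF (x : S) : subcat S := fun M =>
  (forall m : M, x *: m = 0) /\
  exists (a b : nat) (f : {linear 'rV[S]_a -> 'rV[S]_b})
    (g : {linear 'rV[S]_b -> M}), short_exact f g.

(* Modules over S/I are identified with S-modules killed by I.  With this
   identification X * Y is [extensions X Y] over S: an extension of a module
   killed by J by one killed by I is automatically killed by IJ. *)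
Definition star (X Y : subcat S) : subcat S := extensions X Y.

(* X_0 * (X_1 * (... * X_n)) *)
Fixpoint bigstar (n : nat) : ('I_n.+1 -> subcat S) -> subcat S :=
  match n with
  | 0 => fun X => X ord0
  | n'.+1 => fun X => star (X ord0) (bigstar (fun i => X (lift ord0 i)))
  end.

(* An S-subcategory of modules killed by x, seen inside mod S/(x). *)
Definition over_quotr (x : S) (X : subcat S) : subcat (quotr x) :=
  fun M => X (restr (quotr_pi x) M).

Lemma bigstar_MF_ann n (x : 'I_n.+1 -> S) (M : lmodType S) :
  bigstar (fun i => MF (x i)) M -> forall m : M, (\prod_i x i) *: m = 0.
Proof.
elim: n x M => [|n IHn] x M /=; first by rewrite big_ord1 => -[].
case=> [A] [B] [f] [g] [[xA _] /IHn yB [_ ex _]] m.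
rewrite big_ord_recl -scalerA.
have /ex[a <-] : g ((\prod_(i < n.+1) x (lift ord0 i)) *: m) = 0.
  by rewrite linearZ /= yB.
by rewrite -linearZ /= xA linear0.
Qed.
End MatrixFactorizations.

Arguments over_quotr {S} x X _.

(* Every S-module killed by x is the restriction of an S/(x)-module. *)
Section ExtendToQuotient.
Variables (S : comPzRingType) (x : S) (M : lmodType S).
Hypothesis Mx : forall m : M, x *: m = 0.

Definition quotr_mod of (forall m : M, x *: m = 0) : Type := M.
Local Notation M' := (quotr_mod Mx).
HB.instance Definition _ := GRing.Zmodule.on M'.

Definition quotr_scale (a : quotr x) (m : M') : M' :=
  repr (a : Quotient.quot (pideal x)) *: (m : M).

Lemma quotr_scaleE s m : quotr_scale (quotr_pi x s) m = s *: (m : M).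
Proof.
rewrite /quotr_scale; set s' := repr _.
have /quotr_pi_eq[u eu] : quotr_pi x s' = quotr_pi x s by rewrite /quotr_pi reprK.
by apply/eqP; rewrite -subr_eq0 -scalerBl eu -scalerA Mx scaler0.
Qed.

Fact quotr_scaleA a b m :
  quotr_scale a (quotr_scale b m) = quotr_scale (a * b) m.
Proof.
case: (quotr_pi_surj a) (quotr_pi_surj b) => s <- [t <-].
by rewrite -rmorphM !quotr_scaleE scalerA.
Qed.
Fact quotr_scale1 : left_id 1 quotr_scale.
Proof. by move=> m; rewrite -(rmorph1 (quotr_pi x)) quotr_scaleE scale1r. Qed.
Fact quotr_scaleDr : right_distributive quotr_scale +%R.
Proof. by move=> a m m'; rewrite /quotr_scale scalerDr. Qed.
Fact quotr_scaleDl m : {morph quotr_scale^~ m : a b / a + b}.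
Proof.
move=> a b; case: (quotr_pi_surj a) (quotr_pi_surj b) => s <- [t <-].
by rewrite -rmorphD !quotr_scaleE scalerDl.
Qed.
HB.instance Definition _ := GRing.Zmodule_isLmodule.Build (quotr x) M'
  quotr_scaleA quotr_scale1 quotr_scaleDr quotr_scaleDl.

Definition to_quotr_mod (m : M) : restr (quotr_pi x) M' := m.

Fact to_quotr_mod_linear : linear to_quotr_mod.
Proof. by move=> s m m'; congr (_ + _); exact: esym (quotr_scaleE s m). Qed.
HB.instance Definition _ :=
  GRing.isLinear.Build S M (restr (quotr_pi x) M') *:%R to_quotr_mod
    to_quotr_mod_linear.

Lemma restr_quotr_mod : isom M (restr (quotr_pi x) M').
Proof. by exists to_quotr_mod; exists id. Qed.
End ExtendToQuotient.

(* Main.v *)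
(* Over S, let M be an extension of V in MF(x_2)*...*MF(x_n) by N = S^b/f(S^a) in
   MF(x_1), and put y = x_2...x_n.  The S-module V has projective dimension at
   most 1 and is killed by y, so pushing M out along the multiplication
   N = coker f -> coker (yf) by y splits it: M embeds into coker (yf) + V with
   cokernel (S/(y))^b.  Iterating, and using that Ext^1 over S/(y) of S/(z) by
   S/(y) vanishes when z divides y, M embeds into T = sum of coker (y_i f_i),
   y_i = x_(i+1)...x_n, with a cokernel F that is a finite sum of modules S/(z)
   with z dividing r = x_1...x_n.  Each coker (y_i f_i) is a syzygy over S/(x_i y_i)
   of a module in MF(x_i), hence is built in d+1 steps, where d is the supremum
   of the dimensions; and 0 -> M -> T -> F -> 0 gives, up to a free summand of M,
   0 -> syz F -> M -> T -> 0 over S/(r), one more step. *)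
Require Import Defs.
From HB Require Import structures.
From mathcomp Require Import all_boot all_order all_algebra.
From mathcomp Require Import boolp classical_sets constructive_ereal ereal.

Set Implicit Arguments.
Unset Strict Implicit.
Unset Printing Implicit Defensive.

Import Order.TTheory GRing.Theory Num.Theory.
Local Open Scope ring_scope.

(** * Linear maps, direct summands and projective modules *)

Section LinearMaps.
Variable R : pzRingType.
Implicit Types (U V W M N K : lmodType R).

(** Treating an n-fold extension one factor at a time would give a bound growing with [n]. Embedding
    [M] avoids this: a direct sum [T] costs no more than its worst summand, so the constant 1 pays
    once for the syzygy of [F], whatever [n] is. The pushout splits because [V] has a projective
    resolution of length one: the class in Ext^1(V, N) lifts to Ext^1(V, S^b), and N -> coker (yf)
    turns the lift into a multiple by [y], which kills [V]. Dimension, and not radius, stands on the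
    right because an equality MF(x) = [G]_(k+1) puts [G] itself in MF(x); then [G] has a matrix
    factorization, and its syzygies over S/(xy) stay in a finite list up to free summands. The core
    of the argument runs over [S], with S-modules killed by [w] in the role of S/(w)-modules, since
    several quotient rings occur at once. The middle term of an extension must then be required to
    be killed by [w]: over [S] only [w^2] is sure to kill it. *)

Definition mklin U V (f : U -> V) (hf : linear f) : {linear U -> V} :=
  HB.pack f (GRing.isLinear.Build R U V *:%R f hf).

Definition complin U V W (g : {linear V -> W}) (f : {linear U -> V}) :
  {linear U -> W} := g \o f.

Fact idlin_linear U : linear (fun u : U => u). Proof. by []. Qed.
Definition idlin U : {linear U -> U} := mklin (@idlin_linear U).

Fact zerolin_linear U V : linear (fun _ : U => 0 : V).
Proof. by move=> a u v; rewrite scaler0 addr0. Qed.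
Definition zerolin U V : {linear U -> V} := mklin (@zerolin_linear U V).

Fact opplin_linear U V (f : {linear U -> V}) : linear (fun u => - f u).
Proof. by move=> a u v; rewrite linearP opprD scalerN. Qed.
Definition opplin U V (f : {linear U -> V}) := mklin (opplin_linear f).

Fact fstlin_linear U V : linear (fun p : U * V => p.1). Proof. by []. Qed.
Definition fstlin U V : {linear (U * V)%type -> U} := mklin (@fstlin_linear U V).
Fact sndlin_linear U V : linear (fun p : U * V => p.2). Proof. by []. Qed.
Definition sndlin U V : {linear (U * V)%type -> V} := mklin (@sndlin_linear U V).

Fact pairlin_linear U V W (f : {linear U -> V}) (g : {linear U -> W}) :
  linear (fun u => (f u, g u)).
Proof. by move=> a u v; rewrite !linearP. Qed.
Definition pairlin U V W (f : {linear U -> V}) (g : {linear U -> W}) :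
  {linear U -> (V * W)%type} := mklin (pairlin_linear f g).

Fact copairlin_linear U V W (f : {linear U -> W}) (g : {linear V -> W}) :
  linear (fun p : U * V => f p.1 + g p.2).
Proof. by move=> a u v /=; rewrite !linearP scalerDr addrACA. Qed.
Definition copairlin U V W (f : {linear U -> W}) (g : {linear V -> W}) :
  {linear (U * V)%type -> W} := mklin (copairlin_linear f g).

Definition prodlin U V U' V' (f : {linear U -> U'}) (g : {linear V -> V'}) :
  {linear (U * V)%type -> (U' * V')%type} :=
  pairlin (complin f (fstlin U V)) (complin g (sndlin U V)).

Lemma ker_lift K M U (j : {linear K -> M}) (h : {linear U -> M}) :
  injective j -> (forall u, exists k, j k = h u) ->
  exists h' : {linear U -> K}, forall u, j (h' u) = h u.
Proof.
move=> ij /choice[h' h'E].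
have lin : linear h' by move=> a u v; apply: ij; rewrite linearP !h'E linearP.
by exists (mklin lin).
Qed.

Lemma coker_lift V N U (p : {linear V -> N}) (h : {linear V -> U}) :
  surj p -> (forall v, p v = 0 -> h v = 0) ->
  exists h' : {linear N -> U}, forall v, h' (p v) = h v.
Proof.
move=> sp h0; have [s sE] := choice sp.
have hs v : h (s (p v)) = h v.
  by apply/eqP; rewrite -subr_eq0 -linearB h0 // linearB /= sE subrr.
have lin : linear (h \o s).
  move=> a n n'; rewrite /= -[in LHS](sE n) -[in LHS](sE n') -linearP hs.
  by rewrite linearP.
by exists (mklin lin) => v /=; rewrite hs.
Qed.

Lemma isomP M N : isom M N <-> exists (f : {linear M -> N}) (g : {linear N -> M}),
  cancel f g /\ cancel g f.
Proof.
split=> [[f [g fK gK]]|[f [g [fK gK]]]]; last by exists f, g.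
have lin : linear g.
  by move=> a u v; apply: (can_inj fK); rewrite linearP !gK.
by exists f, (mklin lin).
Qed.

Lemma isom_refl M : isom M M.
Proof. by exists (idlin M), id. Qed.

Lemma isom_sym M N : isom M N -> isom N M.
Proof. by case/isomP => f [g [fK gK]]; exists g, f. Qed.

Lemma short_exact_inj U V W (f : {linear U -> V}) (g : {linear V -> W}) :
  short_exact f g -> injective f.
Proof. by case. Qed.

Lemma short_exact_surj U V W (f : {linear U -> V}) (g : {linear V -> W}) :
  short_exact f g -> surj g.
Proof. by case. Qed.

Lemma short_exact_comp0 U V W (f : {linear U -> V}) (g : {linear V -> W}) u :
  short_exact f g -> g (f u) = 0.
Proof. by case=> _ ex _; apply/ex; exists u. Qed.

Lemma short_exact_ker U V W (f : {linear U -> V}) (g : {linear V -> W}) v :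
  short_exact f g -> g v = 0 -> exists u, f u = v.
Proof. by case=> _ ex _ /ex. Qed.

Lemma inj0 U V (f : {linear U -> V}) : (forall u, f u = 0 -> u = 0) -> injective f.
Proof.
move=> h u v e; apply/eqP; rewrite -subr_eq0; apply/eqP/h.
by rewrite linearB /= e subrr.
Qed.

(** A direct summand without a named complement, so that splittings compose and multiply directly;
    [isom_direct_complement] recovers the complement as the kernel of [p]. *)
Definition retract M N : Prop :=
  exists (i : {linear M -> N}) (p : {linear N -> M}), cancel i p.

Lemma isom_retract M N : isom M N -> retract M N.
Proof. by case/isomP => f [g [fK _]]; exists f, g. Qed.

Lemma retract_refl M : retract M M.
Proof. exact/isom_retract/isom_refl. Qed.

Lemma retract_trans N M K : retract M N -> retract N K -> retract M K.
Proof.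
move=> [i [p ip]] [i' [p' ip']]; exists (complin i' i), (complin p p') => m /=.
by rewrite ip' ip.
Qed.

Lemma retract_prodl M N : retract M (M * N)%type.
Proof. by exists (pairlin (idlin M) (zerolin M N)), (fstlin M N). Qed.

Lemma retract_prodr M N : retract N (M * N)%type.
Proof. by exists (pairlin (zerolin N M) (idlin N)), (sndlin M N). Qed.

Lemma retract_prod M N M' N' :
  retract M M' -> retract N N' -> retract (M * N)%type (M' * N')%type.
Proof.
move=> [i [p ip]] [i' [p' ip']]; exists (prodlin i i'), (prodlin p p').
by case=> m n /=; rewrite ip ip'.
Qed.

Lemma retract_zero M N : (forall m : M, m = 0) -> retract M N.
Proof. by move=> M0; exists (zerolin M N), (zerolin N M) => m; rewrite (M0 m). Qed.

Lemma projective_prod M N : projective M -> projective N -> projective (M * N)%type.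
Proof.
move=> pM pN U V g f sg.
have [h hE] := pM U V g (complin f (pairlin (idlin M) (zerolin M N))) sg.
have [k kE] := pN U V g (complin f (pairlin (zerolin N M) (idlin N))) sg.
exists (copairlin h k) => -[m n] /=.
rewrite linearD /= hE kE /= -linearD; congr (f _).
by rewrite /GRing.add /= /add_pair /= add0r addr0.
Qed.

(* An extension of projectives is their direct sum. *)
Lemma projective_ext M N K (f : {linear M -> K}) (g : {linear K -> N}) :
  short_exact f g -> projective M -> projective N -> projective K.
Proof.
move=> se pM pN U V q h sq.
have [s sE] := pN _ _ g (idlin N) (short_exact_surj se).
have [a aE] := pM _ _ q (complin h f) sq.
have [b bE] := pN _ _ q (complin h s) sq.
have lin : linear (fun k : K => k - s (g k)).
  by move=> c k k'; rewrite (linearP g) (linearP s) opprD scalerBr addrACA.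
have [t tE] : exists t : {linear K -> M}, forall k, f (t k) = k - s (g k).
  apply: (@ker_lift _ _ _ f (mklin lin)); first by case: se.
  by move=> k; apply: (short_exact_ker se); rewrite /= linearB /= sE subrr.
exists (copairlin (complin a t) (complin b g) \o pairlin (idlin K) (idlin K)) => k /=.
by rewrite linearD /= aE bE /= tE -linearD subrK.
Qed.

Lemma projective_rV n : projective ('rV[R]_n : lmodType R).
Proof.
move=> M N g f sg.
have /choice[e eE] (i : 'I_n) : exists m, g m = f (delta_mx 0 i) by exact: sg.
have lin : linear (fun v : 'rV[R]_n => \sum_i v 0 i *: e i).
  move=> a u v; rewrite scaler_sumr -big_split; apply: eq_bigr => i _.
  by rewrite !mxE scalerDl scalerA.
exists (mklin lin) => v /=.
rewrite [in RHS](row_sum_delta v) !linear_sum; apply: eq_bigr => i _.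
by rewrite !linearZ /= eE.
Qed.

End LinearMaps.

Arguments idlin {R} U.
Arguments zerolin {R} U V.
Arguments fstlin {R} U V.
Arguments sndlin {R} U V.

(** * Kernels and cokernels as modules *)

Section Kernel.
Variables (R : pzRingType) (U V : lmodType R) (f : {linear U -> V}).

Definition kermod_pred : {pred U} := fun u => f u == 0.

Fact kermod_submod_closed : submod_closed kermod_pred.
Proof.
split=> [|a u v /eqP fu /eqP fv]; first by apply/eqP; rewrite linear0.
by apply/eqP; rewrite linearP fu fv scaler0 addr0.
Qed.
HB.instance Definition _ :=
  GRing.isSubmodClosed.Build R U kermod_pred kermod_submod_closed.

Record kermod := KerMod { kermod_val : U; _ : kermod_val \in kermod_pred }.
HB.instance Definition _ := [isSub for kermod_val].
HB.instance Definition _ := [Choice of kermod by <:].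
HB.instance Definition _ := [SubChoice_isSubLmodule of kermod by <:].

Fact kermod_val_linear : linear kermod_val. Proof. by []. Qed.
Definition ker_incl : {linear kermod -> U} := mklin kermod_val_linear.

Lemma ker_incl_inj : injective ker_incl.
Proof. exact: val_inj. Qed.

Lemma ker_exact : exact_at ker_incl f.
Proof.
move=> u; split=> [fu|[k <-]]; last by apply/eqP; exact: (valP k).
by have ku : u \in kermod_pred by [apply/eqP]; exists (KerMod ku).
Qed.

Lemma ker_short_exact : surj f -> short_exact ker_incl f.
Proof. by split=> //; [exact: ker_incl_inj | exact: ker_exact]. Qed.

End Kernel.

Section Cokernel.
Variables (R : pzRingType) (U V : lmodType R) (f : {linear U -> V}).

Definition coker_pred : {pred V} := fun v => `[< exists u, f u = v >].

Fact coker_zmod_closed : zmod_closed coker_pred.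
Proof.
split; first by apply/asboolP; exists 0; rewrite linear0.
move=> _ _ /asboolP[u <-] /asboolP[v <-].
by apply/asboolP; exists (u - v); rewrite linearB.
Qed.
HB.instance Definition _ := GRing.isZmodClosed.Build V coker_pred coker_zmod_closed.

Definition coker : Type := Quotient.quot coker_pred.
HB.instance Definition _ := GRing.Zmodule.on coker.

Definition coker_pi (v : V) : coker := (\pi_(Quotient.quot coker_pred) v)%qT.

Lemma coker_pi_eq u v : coker_pi u = coker_pi v <-> exists w, f w = u - v.
Proof.
split; last by move=> h; apply/eqP; rewrite -Quotient.idealrBE; apply/asboolP.
by move/eqP; rewrite -Quotient.idealrBE => /asboolP.
Qed.

Lemma coker_pi_surj (c : coker) : exists v, coker_pi v = c.
Proof. by exists (repr (c : Quotient.quot coker_pred)); rewrite /coker_pi reprK. Qed.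

Fact coker_piD u v : coker_pi (u + v) = coker_pi u + coker_pi v.
Proof. by rewrite /coker_pi piE. Qed.

Definition coker_scale (a : R) (c : coker) : coker :=
  coker_pi (a *: repr (c : Quotient.quot coker_pred)).

Lemma coker_scaleE a v : coker_scale a (coker_pi v) = coker_pi (a *: v).
Proof.
rewrite /coker_scale; set v' := repr _; apply/coker_pi_eq.
have /coker_pi_eq[w we] : coker_pi v' = coker_pi v by rewrite /coker_pi reprK.
by exists (a *: w); rewrite linearZ /= we scalerBr.
Qed.

Fact coker_scaleA a b c : coker_scale a (coker_scale b c) = coker_scale (a * b) c.
Proof. by case: (coker_pi_surj c) => v <-; rewrite !coker_scaleE scalerA. Qed.
Fact coker_scale1 : left_id 1 coker_scale.
Proof. by move=> c; case: (coker_pi_surj c) => v <-; rewrite coker_scaleE scale1r. Qed.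
Fact coker_scaleDr : right_distributive coker_scale +%R.
Proof.
move=> a c d; case: (coker_pi_surj c) (coker_pi_surj d) => u <- [v <-].
by rewrite -coker_piD !coker_scaleE scalerDr coker_piD.
Qed.
Fact coker_scaleDl c : {morph coker_scale^~ c : a b / a + b}.
Proof.
move=> a b; case: (coker_pi_surj c) => v <-.
by rewrite !coker_scaleE scalerDl coker_piD.
Qed.
HB.instance Definition _ := GRing.Zmodule_isLmodule.Build R coker
  coker_scaleA coker_scale1 coker_scaleDr coker_scaleDl.

Fact coker_pi_linear : linear coker_pi.
Proof. by move=> a u v; rewrite coker_piD -coker_scaleE. Qed.
Definition coker_proj : {linear V -> coker} := mklin coker_pi_linear.

Lemma coker_proj_surj : surj coker_proj.
Proof. exact: coker_pi_surj. Qed.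

Lemma coker_exact : exact_at f coker_proj.
Proof.
move=> v; split=> [e|[u <-]].
  have /coker_pi_eq[u] : coker_pi v = coker_pi 0.
    exact: etrans e (esym (linear0 coker_proj)).
  by rewrite subr0 => <-; exists u.
by apply: etrans (linear0 coker_proj); apply/coker_pi_eq; exists u; rewrite subr0.
Qed.

Lemma coker_short_exact : injective f -> short_exact f coker_proj.
Proof. by split=> //; [exact: coker_exact | exact: coker_proj_surj]. Qed.

End Cokernel.

(** * Exact sequences, the horseshoe lemma and Schanuel's lemma *)

Section ExactSequences.
Variable R : pzRingType.
Implicit Types A B E F K M N P T U V W : lmodType R.

Lemma short_exact_prod A E B A' E' B' (f : {linear A -> E}) (g : {linear E -> B})
    (f' : {linear A' -> E'}) (g' : {linear E' -> B'}) :
  short_exact f g -> short_exact f' g' -> short_exact (prodlin f f') (prodlin g g').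
Proof.
move=> se se'; split.
- case=> a a' [b b'] [/(short_exact_inj se) <- /(short_exact_inj se') <-] //.
- case=> e e'; split=> [[ge ge']|[[a a'] [<- <-]]].
    have [a <-] := short_exact_ker se ge.
    by have [a' <-] := short_exact_ker se' ge'; exists (a, a').
  by congr (_, _); rewrite /= (short_exact_comp0 _ se, short_exact_comp0 _ se').
- case=> b b'; have [e <-] := short_exact_surj se b.
  by have [e' <-] := short_exact_surj se' b'; exists (e, e').
Qed.

Lemma short_exact_0r M N : (forall n : N, n = 0) ->
  short_exact (idlin M) (zerolin M N).
Proof.
by move=> N0; split=> // [m|n]; [split=> // _; exists m | exists 0; rewrite (N0 n)].
Qed.

Lemma coker_isom A E B (f : {linear A -> E}) (g : {linear E -> B}) :
  short_exact f g -> isom (coker f) B.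
Proof.
move=> se; apply/isomP.
have [h hE] : exists h : {linear coker f -> B}, forall e, h (coker_proj f e) = g e.
  apply: coker_lift; first exact: coker_proj_surj.
  by move=> e /coker_exact[a <-]; exact: short_exact_comp0 se.
have [k kE] : exists k : {linear B -> coker f}, forall e, k (g e) = coker_proj f e.
  apply: coker_lift; first exact: short_exact_surj se.
  by move=> e /(short_exact_ker se)[a <-]; apply/coker_exact; exists a.
exists h, k; split=> [c|b].
  by have [e <-] := coker_proj_surj c; rewrite hE kE.
by have [e <-] := short_exact_surj se b; rewrite kE hE.
Qed.

(* For f = b o c with b injective, the kernel of coker f -> coker b is the
   image of b modulo the image of f, that is, coker c. *)
Lemma coker_comp_exact U V W (f : {linear U -> W}) (b : {linear V -> W})
    (c : {linear U -> V}) :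
  injective b -> (forall u, f u = b (c u)) ->
  exists (i : {linear coker c -> coker f}) (p : {linear coker f -> coker b}),
    [/\ short_exact i p, forall v, i (coker_proj c v) = coker_proj f (b v)
      & forall w, p (coker_proj f w) = coker_proj b w].
Proof.
move=> bI fE.
have [i iE] : exists i : {linear coker c -> coker f},
    forall v, i (coker_proj c v) = coker_proj f (b v).
  apply: (@coker_lift _ _ _ _ _ (complin (coker_proj f) b)); first exact: coker_proj_surj.
  by move=> v /coker_exact[u <-]; apply/coker_exact; exists u.
have [p pE] : exists p : {linear coker f -> coker b},
    forall w, p (coker_proj f w) = coker_proj b w.
  apply: coker_lift; first exact: coker_proj_surj.
  by move=> w /coker_exact[u <-]; apply/coker_exact; exists (c u).
exists i, p; split=> //; split.
- apply: inj0 => x; have [v <-] := coker_proj_surj x; rewrite iE => /coker_exact[u].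
  by rewrite fE => /bI <-; apply/coker_exact; exists u.
- move=> x; have [w <-] := coker_proj_surj x; rewrite pE.
  split=> [/coker_exact[v <-]|[y]]; first by exists (coker_proj c v).
  have [v <-] := coker_proj_surj y; rewrite iE => /esym e.
  rewrite -pE e pE; apply/coker_exact; by exists v.
- by move=> x; have [w <-] := coker_proj_surj x; exists (coker_proj f w).
Qed.

(* Horseshoe lemma; only the lift of the right cover is needed. *)
Lemma horseshoe (A E B KA FA KB FB : lmodType R)
    (f : {linear A -> E}) (g : {linear E -> B})
    (jA : {linear KA -> FA}) (pA : {linear FA -> A})
    (jB : {linear KB -> FB}) (pB : {linear FB -> B}) (l : {linear FB -> E}) :
  short_exact f g -> short_exact jA pA -> short_exact jB pB ->
  (forall b, g (l b) = pB b) ->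
  exists (K : lmodType R) (j : {linear K -> (FA * FB)%type})
    (p : {linear (FA * FB)%type -> E}) (u : {linear KA -> K}) (v : {linear K -> KB}),
    short_exact j p /\ short_exact u v.
Proof.
move=> se seA seB lE.
pose p := copairlin (complin f pA) l; pose j := ker_incl p.
have jk k : f (pA (j k).1) + l (j k).2 = 0 by apply/(ker_exact p); exists k.
have sp : surj p.
  move=> e; have [b bE] := short_exact_surj seB (g e).
  have [a aE] : exists a, f a = e - l b.
    by apply: (short_exact_ker se); rewrite linearB /= lE bE subrr.
  have [c cE] := short_exact_surj seA a.
  by exists (c, b); rewrite /= cE aE subrK.
have [u uE] : exists u : {linear KA -> kermod p}, forall k, j (u k) = (jA k, 0).
  apply: (@ker_lift _ _ _ _ j (pairlin jA (zerolin KA FB))).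
    exact: ker_incl_inj.
  move=> k; apply/ker_exact.
  by rewrite /= (short_exact_comp0 _ seA) !linear0 addr0.
have [v vE] : exists v : {linear kermod p -> KB}, forall k, jB (v k) = (j k).2.
  apply: (@ker_lift _ _ _ _ jB (complin (sndlin FA FB) j)); first by case: seB.
  move=> k; apply: (short_exact_ker seB) => /=; rewrite -lE.
  have /eqP := jk k; rewrite addrC addr_eq0 => /eqP ->.
  by rewrite linearN /= (short_exact_comp0 _ se) oppr0.
exists (kermod p), j, p, u, v; split; first exact: ker_short_exact.
split.
- move=> k k' e; apply: (short_exact_inj seA).
  by have := uE k; rewrite e uE => -[].
- move=> k; split=> [vk|[a <-]].
    have k2 : (j k).2 = 0 by rewrite -vE vk linear0.
    have [a aE] : exists a, jA a = (j k).1.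
      apply: (short_exact_ker seA); apply: (short_exact_inj se).
      by rewrite linear0; have := jk k; rewrite k2 linear0 addr0.
    exists a; apply: (@ker_incl_inj _ _ _ p).
    by rewrite -/j uE aE -k2; case: (j k).
  apply: (short_exact_inj seB); rewrite vE uE linear0 //.
- move=> b; have [a aE] : exists a, f a = l (jB b).
    by apply: (short_exact_ker se); rewrite lE (short_exact_comp0 _ seB).
  have [c cE] := short_exact_surj seA a.
  have [k kE] : exists k, j k = (- c, jB b).
    by apply/ker_exact; rewrite /= !linearN /= cE aE addNr.
  by exists k; apply: (short_exact_inj seB); rewrite vE kE.
Qed.

(* One-sided Schanuel lemma: lift the maps between M and N to the covers; the
   composite F -> P -> F differs from the identity by a map into the kernel. *)
Lemma retract_syzygy M N K F K' P (i : {linear M -> N}) (p : {linear N -> M})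
    (j : {linear K -> F}) (q : {linear F -> N})
    (j' : {linear K' -> P}) (q' : {linear P -> M})
    (h : {linear P -> F}) (g : {linear F -> P}) :
  cancel i p -> short_exact j q -> short_exact j' q' ->
  (forall x, q (h x) = i (q' x)) -> (forall y, q' (g y) = p (q y)) ->
  retract K' (K * P)%type.
Proof.
move=> ip se se' hE gE.
have [hk hkE] : exists hk : {linear K' -> K}, forall x, j (hk x) = h (j' x).
  apply: (@ker_lift _ _ _ _ j (complin h j')); first by case: se.
  move=> x; apply: (short_exact_ker se).
  by rewrite /= hE (short_exact_comp0 _ se') linear0.
have [gk gkE] : exists gk : {linear K -> K'}, forall x, j' (gk x) = g (j x).
  apply: (@ker_lift _ _ _ _ j' (complin g j)); first by case: se'.
  move=> x; apply: (short_exact_ker se').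
  by rewrite /= gE (short_exact_comp0 _ se) linear0.
pose d := copairlin (opplin (complin g h)) (idlin P) \o pairlin (idlin P) (idlin P).
have [t tE] : exists t : {linear P -> K'}, forall x, j' (t x) = - g (h x) + x.
  apply: (@ker_lift _ _ _ _ j' d); first by case: se'.
  move=> x; apply: (short_exact_ker se').
  by rewrite /= linearD /= linearN /= gE hE ip addNr.
exists (pairlin hk j'), (copairlin gk t) => x /=.
by apply: (short_exact_inj se'); rewrite linearD /= tE gkE hkE addrA subrr add0r.
Qed.

End ExactSequences.

(** * Modules built by extensions over S/(w), and their syzygies *)

Section Built.
Variable S : comPzRingType.
Implicit Types (w : S) (X : subcat S) (A B E F K M N P T : lmodType S).

Definition killed w M : Prop := forall m : M, w *: m = 0.

(** Projectivity over S/(w), tested on S-modules: [N] is killed by [w] too, as an image of [M]. *)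
Definition proj_killed w P : Prop :=
  forall M N (g : {linear M -> N}) (f : {linear P -> N}), killed w M -> surj g ->
  exists h : {linear P -> M}, forall p, g (h p) = f p.

Lemma killed_inj w M N (f : {linear M -> N}) : injective f -> killed w N -> killed w M.
Proof. by move=> fI kN m; apply: fI; rewrite linearZ /= kN linear0. Qed.

Lemma killed_surj w M N (f : {linear M -> N}) : surj f -> killed w M -> killed w N.
Proof. by move=> sf kM n; have [m <-] := sf n; rewrite -linearZ /= kM linear0. Qed.

Lemma killed_prod w M N : killed w M -> killed w N -> killed w (M * N)%type.
Proof. by move=> kM kN [m n]; congr (_, _); [exact: kM | exact: kN]. Qed.

Lemma killed_retract w M N : retract M N -> killed w N -> killed w M.
Proof. by case=> i [p /can_inj]; exact: killed_inj. Qed.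

Lemma killed_mul v w M : killed v M -> killed (v * w) M.
Proof. by move=> kM m; rewrite mulrC -scalerA kM scaler0. Qed.

Lemma zero_rV0 (v : 'rV[S]_0) : v = 0.
Proof. by apply/rowP => -[]. Qed.

Lemma proj_killed_prod w M N :
  proj_killed w M -> proj_killed w N -> proj_killed w (M * N)%type.
Proof.
move=> pM pN U V g f kU sg.
have [h hE] := pM U V g (complin f (pairlin (idlin M) (zerolin M N))) kU sg.
have [k kE] := pN U V g (complin f (pairlin (zerolin N M) (idlin N))) kU sg.
exists (copairlin h k) => -[m n] /=.
rewrite linearD /= hE kE /= -linearD; congr (f _).
by rewrite /GRing.add /= /add_pair /= add0r addr0.
Qed.

(* [built w X k] is [X]_(k+1) without the closure under syzygies, for S/(w)-modules
   regarded as S-modules killed by w. *)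
Inductive built w X : nat -> lmodType S -> Prop :=
| built_base k M : X M -> built w X k M
| built_zero k : built w X k 'rV[S]_0
| built_prod k M N : built w X k M -> built w X k N -> built w X k (M * N)%type
| built_retract k M N : retract M N -> built w X k N -> built w X k M
| built_ext k A E B (f : {linear A -> E}) (g : {linear E -> B}) :
    short_exact f g -> killed w E -> built w X k A -> built w X 0 B ->
    built w X k.+1 E.

Lemma built_isom w X k M N : isom M N -> built w X k N -> built w X k M.
Proof. by move/isom_retract; exact: built_retract. Qed.

Lemma built_null w X k M : (forall m : M, m = 0) -> built w X k M.
Proof. by move=> M0; apply: (built_retract (retract_zero _ M0)) (built_zero _ _ _). Qed.

Lemma built_killed w X k M : (forall N, X N -> killed w N) -> built w X k M -> killed w M.
Proof.
move=> kX; elim=> {k M} [k M /kX //|k v|k M N _ kM _ kN|k M N /killed_retract kM _|//].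
- by rewrite (zero_rV0 v) scaler0.
- exact: killed_prod.
- exact: kM.
Qed.

Lemma built_S w X k M : built w X k M -> built w X k.+1 M.
Proof.
elim=> {k M}.
- by move=> k M XM; exact: built_base.
- by move=> k; exact: built_zero.
- by move=> k M N _ bM _ bN; exact: built_prod.
- by move=> k M N r _; exact: built_retract.
- by move=> k A E B f g se kE _ bA bB _; exact: built_ext se kE bA bB.
Qed.

Lemma built_le w X k k' M : (k <= k')%N -> built w X k M -> built w X k' M.
Proof. by move=> /subnK <-; elim: (k' - k)%N => // n IHn /IHn; exact: built_S. Qed.

Lemma built_mono w X w' X' k k' M :
  (forall N, killed w N -> killed w' N) -> (forall N, X N -> built w' X' 0 N) ->
  (k <= k')%N -> built w X k M -> built w' X' k' M.
Proof.
move=> ww XX kk bM; apply: built_le kk _; elim: bM => {k k' M}.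
- by move=> k M /XX; exact: built_le.
- by move=> k; exact: built_zero.
- by move=> k M N _ bM _ bN; exact: built_prod.
- by move=> k M N r _; exact: built_retract.
- by move=> k A E B f g se /ww kE _ bA _ bB; exact: built_ext se kE bA bB.
Qed.

(** Sums of extensions are extensions of sums and retracts compose, so the retracts in a derivation
    can be moved outermost. What remains is the short exact sequence that the induction in
    [built_ext_cons] takes apart. *)
Lemma built_normal w X k T : (forall N, X N -> killed w N) -> built w X k.+1 T ->
  exists T' A B (f : {linear A -> T'}) (g : {linear T' -> B}),
    [/\ retract T T', killed w T', short_exact f g, built w X k A & built w X 0 B].
Proof.
move=> kX; move kk: k.+1 => k' bT; elim: bT k kk => {k' T}.
- move=> k' M XM k _; exists M, M, 'rV[S]_0, (idlin M), (zerolin _ _); split.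
  + exact: retract_refl.
  + exact: kX.
  + by apply: short_exact_0r; exact: zero_rV0.
  + exact: built_base.
  + exact: built_zero.
- move=> k' k _; exists 'rV[S]_0, 'rV[S]_0, 'rV[S]_0, (idlin _), (zerolin _ _); split.
  + exact: retract_refl.
  + by move=> v; exact: zero_rV0.
  + by apply: short_exact_0r; exact: zero_rV0.
  + exact: built_zero.
  + exact: built_zero.
- move=> k' M N _ IHM _ IHN k kk.
  have [T1 [A1 [B1 [f1 [g1 [r1 k1 se1 bA1 bB1]]]]]] := IHM k kk.
  have [T2 [A2 [B2 [f2 [g2 [r2 k2 se2 bA2 bB2]]]]]] := IHN k kk.
  exists (T1 * T2)%type, (A1 * A2)%type, (B1 * B2)%type, (prodlin f1 f2), (prodlin g1 g2).
  split; [exact: retract_prod | exact: killed_prod | exact: short_exact_prod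
         | exact: built_prod | exact: built_prod].
- move=> k' M N r _ IH k kk; have [T [A [B [f [g [r' kT se bA bB]]]]]] := IH k kk.
  by exists T, A, B, f, g; split=> //; exact: retract_trans r r'.
- move=> k' A E B f g se kE bA _ bB _ k [->]; exists E, A, B, f, g.
  by split=> //; exact: retract_refl.
Qed.

(** Extensions are associative: [built_ext] adds a one-step quotient on top, here a one-step
    submodule goes in at the bottom. The regrouped middle terms are submodules of E + T', hence
    still killed by [w]. *)
Lemma built_ext_cons w X k A E T (f : {linear A -> E}) (g : {linear E -> T}) :
  (forall N, X N -> killed w N) -> short_exact f g -> killed w E ->
  built w X 0 A -> built w X k T -> built w X k.+1 E.
Proof.
move=> kX; elim: k A E T f g => [|k IHk] A E T f g se kE bA bT.
  exact: built_ext se kE bA bT.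
have [T' [A' [B' [f' [g' [[i [p ip]] kT' se' bA' bB']]]]]] := built_normal kX bT.
(* E1 is the pullback of E -> T along p, and E2 the preimage of A' in E1. *)
pose d := copairlin (opplin g) p : {linear (E * T')%type -> T}.
pose E1 := kermod d.
have [j [jI jd]] : exists j : {linear E1 -> (E * T')%type}, injective j /\ exact_at j d.
  by exists (ker_incl d); split; [exact: ker_incl_inj | exact: ker_exact].
have jE (x : E1) : p (j x).2 = g (j x).1.
  by apply/eqP; rewrite -subr_eq0 addrC; apply/eqP/jd; exists x.
have jX e t : g e = p t -> exists x : E1, j x = (e, t).
  by move=> e1; apply/jd; rewrite /= e1 addNr.
pose q := complin g' (complin (sndlin E T') j) : {linear E1 -> B'}.
have kE1 : killed w E1 by apply: killed_inj jI _; exact: killed_prod.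
have sq : surj q.
  move=> b; have [t <-] := short_exact_surj se' b.
  have [e eE] := short_exact_surj se (p t).
  by have [x xE] := jX _ _ eE; exists x; rewrite /= xE.
have rE : retract E E1.
  have [s sE] : exists s : {linear E -> E1}, forall e, j (s e) = (e, i (g e)).
    apply: (@ker_lift _ _ _ _ j (pairlin (idlin E) (complin i g)) jI) => e.
    by apply: jX; rewrite ip.
  by exists s, (complin (fstlin E T') j) => e; rewrite /= sE.
apply: built_retract rE _.
have [E2 [y [yI yex]]] : exists E2 (y : {linear E2 -> E1}), injective y /\ exact_at y q.
  by exists (kermod q), (ker_incl q); split; [exact: ker_incl_inj | exact: ker_exact].
have se1 : short_exact y q by [].
apply: (built_ext se1 kE1 _ bB').
pose j2 := complin j y.
have j2I : injective j2 by move=> u u' /jI /yI.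
have [u uE] : exists u : {linear A -> E1}, forall a, j (u a) = (f a, 0).
  apply: (@ker_lift _ _ _ _ j (pairlin f (zerolin A T')) jI) => a.
  by apply: jX; rewrite (short_exact_comp0 _ se) linear0.
have [u2 u2E] : exists u2 : {linear A -> E2}, forall a, j2 (u2 a) = (f a, 0).
  have [u2 u2E] : exists u2 : {linear A -> E2}, forall a, y (u2 a) = u a.
    apply: (@ker_lift _ _ _ _ y u); first exact: yI.
    by move=> a; apply/yex; rewrite /= uE linear0.
  by exists u2 => a; rewrite /= u2E uE.
have [v vE] : exists v : {linear E2 -> A'}, forall x, f' (v x) = (j2 x).2.
  apply: (@ker_lift _ _ _ _ f' (complin (sndlin E T') j2)); first by case: se'.
  move=> x; apply: (short_exact_ker se').
  by have : q (y x) = 0 by [apply/yex; exists x].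
apply: (IHk A _ A' u2 v _ (killed_inj yI kE1) bA bA').
split.
- move=> a a' e; apply: (short_exact_inj se).
  by have := u2E a; rewrite e u2E => -[].
- move=> x; split=> [vx|[a <-]].
    have x2 : (j2 x).2 = 0 by rewrite -vE vx linear0.
    have [a aE] : exists a, f a = (j2 x).1.
      apply: (short_exact_ker se); have := jE (y x).
      by rewrite -/(j2 x) [(j _).2]x2 linear0.
    by exists a; apply: j2I; rewrite u2E aE -x2; case: (j2 x).
  by apply: (short_exact_inj se'); rewrite vE u2E linear0.
- move=> a; have [e eE] := short_exact_surj se (p (f' a)).
  have [x xE] := jX _ _ eE.
  have [z zE] : exists z, y z = x.
    by apply/yex; rewrite /= xE (short_exact_comp0 _ se').
  by exists z; apply: (short_exact_inj se'); rewrite vE /= zE xE.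
Qed.

(** The cover [F] must itself be built in one step, so that the projective summands produced by
    Schanuel's lemma cost nothing. *)
Definition covered w X k M : Prop :=
  exists K F (j : {linear K -> F}) (p : {linear F -> M}),
    [/\ short_exact j p, built w X k K, built w X 0 F, killed w F & proj_killed w F].

Lemma covered_zero w X k : covered w X k 'rV[S]_0.
Proof.
exists 'rV[S]_0, 'rV[S]_0, (idlin _), (zerolin _ _); split.
- by apply: short_exact_0r; exact: zero_rV0.
- exact: built_zero.
- exact: built_zero.
- by move=> v; exact: zero_rV0.
- by move=> M N g f _ _; exists (zerolin _ _) => v; rewrite (zero_rV0 v) !linear0.
Qed.

Lemma covered_prod w X k M N :
  covered w X k M -> covered w X k N -> covered w X k (M * N)%type.
Proof.
move=> [K [F [j [p [se bK bF kF pF]]]]] [K' [F' [j' [p' [se' bK' bF' kF' pF']]]]].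
exists (K * K')%type, (F * F')%type, (prodlin j j'), (prodlin p p').
split; [exact: short_exact_prod | exact: built_prod | exact: built_prod
       | exact: killed_prod | exact: proj_killed_prod].
Qed.

(** This is why [built] can omit closure under syzygies: once each generator has a cover with a
    one-step syzygy, the horseshoe lemma handles extensions and Schanuel's lemma handles
    summands. *)
Lemma built_covered w X k M :
  (forall N, X N -> killed w N) -> (forall N, X N -> covered w X 0 N) ->
  built w X k M -> covered w X k M.
Proof.
move=> kX cX; elim=> {k M}.
- move=> k M /cX[K [F [j [p [se bK bF kF pF]]]]].
  by exists K, F, j, p; split=> //; exact: built_le bK.
- by move=> k; exact: covered_zero.
- by move=> k M N _ cM _ cN; exact: covered_prod.
- move=> k M N [i [p ip]] _ [K [F [j [q [se bK bF kF pF]]]]].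
  (* The cover of [N] serves for its summand [M]; Schanuel's lemma makes the new kernel a summand of
     K + F. *)
  have sp : surj (complin p q).
    move=> m; have [y yE] := short_exact_surj se (i m).
    by exists y; rewrite /= yE ip.
  have [h hE] := pF _ _ q (complin i (complin p q)) kF (short_exact_surj se).
  exists (kermod (complin p q)), F, (ker_incl _), (complin p q); split=> //.
    exact: ker_short_exact.
  have r := retract_syzygy ip se (ker_short_exact sp) hE (g := idlin F) (frefl _).
  by apply: built_retract r _; apply: built_prod bK _; exact: built_le bF.
- move=> k A E B f g se kE bA [KA [FA [jA [pA [seA bKA bFA kFA pFA]]]]].
  move=> bB [KB [FB [jB [pB [seB bKB bFB kFB pFB]]]]].
  have [l lE] := pFB _ _ g pB kE (short_exact_surj se).
  have [K [j [p [u [v [seK seuv]]]]]] := horseshoe se seA seB lE.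
  exists K, (FA * FB)%type, j, p.
  have kF : killed w (FA * FB)%type by exact: killed_prod.
  split.
  + exact: seK.
  + exact: built_ext seuv (killed_inj (short_exact_inj seK) kF) bKA bKB.
  + exact: built_prod.
  + exact: kF.
  + exact: proj_killed_prod.
Qed.

(** [built_covered] controls one syzygy; Schanuel's lemma, applied to the identity of [M], carries
    the bound over to the kernel of any other projective cover built in one step. *)
Lemma built_syzygy w X k M K P (j : {linear K -> P}) (q : {linear P -> M}) :
  (forall N, X N -> killed w N) -> (forall N, X N -> covered w X 0 N) ->
  built w X k M -> short_exact j q -> killed w P -> proj_killed w P ->
  built w X 0 P -> built w X k K.
Proof.
move=> kX cX bM se kP pP bP.
have [K' [F [j' [q' [se' bK' bF kF pF]]]]] := built_covered kX cX bM.
have [h hE] := pP _ _ q' q kF (short_exact_surj se').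
have [g gE] := pF _ _ q q' kP (short_exact_surj se).
have r := @retract_syzygy _ _ _ _ _ _ _ (idlin M) (idlin M) _ _ _ _ h g (frefl _) se' se hE gE.
by apply: built_retract r _; apply: built_prod bK' _; exact: built_le bP.
Qed.

(* From 0 -> M -> T -> F -> 0, a cover of F gives 0 -> K -> M + P -> T -> 0
   with K a syzygy of F. *)
Lemma built_subobject w X k M T F (i : {linear M -> T}) (q : {linear T -> F}) :
  (forall N, X N -> killed w N) -> short_exact i q -> killed w T ->
  built w X k T -> covered w X 0 F -> built w X k.+1 M.
Proof.
move=> kX se kT bT [K [P [j [p [se' bK bP kP pP]]]]].
have [h hE] := pP _ _ q p kT (short_exact_surj se).
pose g := copairlin i h : {linear (M * P)%type -> T}.
have [f fE] : exists f : {linear K -> M}, forall x, i (f x) = - h (j x).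
  apply: (@ker_lift _ _ _ _ i (opplin (complin h j))); first by case: se.
  move=> x; apply: (short_exact_ker se).
  by rewrite linearN /= hE (short_exact_comp0 _ se') oppr0.
apply: (built_retract (retract_prodl M P)).
apply: (@built_ext_cons _ _ _ K _ T (pairlin f j) g kX _ _ bK bT); last first.
  apply: killed_prod kP; apply: killed_inj kT; exact: short_exact_inj se.
split.
- by move=> x y [_ /(short_exact_inj se')].
- case=> m y; split=> [/= e|[x [<- <-]]]; last by rewrite /= fE addNr.
  have qh : q (h y) = 0.
    have : q (i m + h y) = 0 by rewrite e linear0.
    by rewrite linearD /= (short_exact_comp0 _ se) add0r.
  have [x xE] : exists x, j x = y by apply: (short_exact_ker se'); rewrite -hE.
  exists x; rewrite /= xE; congr (_, _); apply: (short_exact_inj se).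
  by rewrite fE xE; apply/eqP; rewrite eq_sym -addr_eq0 e.
- move=> t; have [y yE] := short_exact_surj se' (q t).
  have [m mE] : exists m, i m = t - h y.
    by apply: (short_exact_ker se); rewrite linearB /= hE yE subrr.
  by exists (m, y); rewrite /= mE subrK.
Qed.

End Built.

(** * Matrix factorizations and their cokernels over S/(xy) *)

Section Factorizations.
Variable S : comPzRingType.
Implicit Types (w x y : S) (X : subcat S) (E M N P U V : lmodType S).

Fact scal_linear w M : linear (fun m : M => w *: m).
Proof. by move=> a u v; rewrite scalerDr !scalerA mulrC. Qed.
Definition scal w M : {linear M -> M} := mklin (scal_linear w (M := M)).

(** The module (S/(w))^m, presented over [S] so that maps out of it are given on S^m. *)
Definition free_mod w m : lmodType S := coker (scal w 'rV[S]_m).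

Lemma coker_killed w U V (f : {linear U -> V}) :
  (forall v, exists u, f u = w *: v) -> killed w (coker f).
Proof.
move=> fw c; have [v <-] := coker_proj_surj c.
by rewrite -linearZ; apply/coker_exact/fw.
Qed.

Lemma free_mod_killed w m : killed w (free_mod w m).
Proof. by apply: coker_killed => v; exists v. Qed.

Lemma free_mod_proj w m : proj_killed w (free_mod w m).
Proof.
move=> M N g f kM sg.
have [h hE] := projective_rV (complin f (coker_proj _)) sg.
have [h' h'E] : exists h' : {linear free_mod w m -> M},
    forall v, h' (coker_proj _ v) = h v.
  apply: coker_lift; first exact: coker_proj_surj.
  by move=> v /coker_exact[u <-]; rewrite /= linearZ /= kM.
exists h' => c; have [v <-] := coker_proj_surj c.
by rewrite h'E hE.
Qed.

Lemma lreg_scal_inj w n : GRing.lreg w -> injective (scal w 'rV[S]_n).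
Proof.
move=> rw; apply: inj0 => u /rowP e; apply/rowP => i; apply: rw.
by have := e i; rewrite !mxE mulr0.
Qed.

Lemma coker_eq_isom U V (f g : {linear U -> V}) :
  injective f -> f =1 g -> isom (coker f) (coker g).
Proof.
move=> fI fg; apply: (@coker_isom _ _ _ _ f (coker_proj g)).
split=> // [v|]; last exact: coker_proj_surj.
by split=> [/coker_exact[u <-]|[u <-]]; [exists u | apply/coker_exact; exists u].
Qed.

Definition mf_pair x a b (A : {linear 'rV[S]_a -> 'rV[S]_b})
    (B : {linear 'rV[S]_b -> 'rV[S]_a}) : Prop :=
  [/\ injective A, injective B, forall v, A (B v) = x *: v & forall u, B (A u) = x *: u].

Lemma mf_pairC x a b (A : {linear 'rV[S]_a -> 'rV[S]_b})
  (B : {linear 'rV[S]_b -> 'rV[S]_a}) : mf_pair x A B -> mf_pair x B A.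
Proof. by case. Qed.

(** As [x] kills [M], multiplication by [x] on S^b lands in the image of [f]; factoring it through
    [f] gives the other half of Eisenbud's matrix factorization. *)
Lemma mf_pair_exists x a b M (f : {linear 'rV[S]_a -> 'rV[S]_b})
    (g : {linear 'rV[S]_b -> M}) :
  GRing.lreg x -> killed x M -> short_exact f g -> exists B, mf_pair x f B.
Proof.
move=> rx kM se; have fI := short_exact_inj se.
have [B BE] : exists B : {linear 'rV[S]_b -> 'rV[S]_a}, forall v, f (B v) = x *: v.
  apply: (@ker_lift _ _ _ _ f (scal x 'rV[S]_b) fI) => v.
  by apply: (short_exact_ker se); rewrite /= linearZ /= kM.
exists B; split=> // [|u]; last by apply: fI; rewrite BE linearZ.
move=> u v e; apply: (lreg_scal_inj rx).
by rewrite /= -!BE e.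
Qed.

Lemma mf_pair_MF x a b (A : {linear 'rV[S]_a -> 'rV[S]_b})
  (B : {linear 'rV[S]_b -> 'rV[S]_a}) : mf_pair x A B -> MF x (coker A).
Proof.
case=> AI BI AB BA; split; first by apply: coker_killed => v; exists (B v).
by exists a, b, A, (coker_proj A); exact: coker_short_exact.
Qed.

Lemma MF_isom x M N : isom M N -> MF x M -> MF x N.
Proof.
move=> /isomP[h [k [hK kK]]] [kM [a [b [f [g se]]]]].
split; first by apply: killed_inj kM; exact: can_inj kK.
exists a, b, f, (complin h g); split; first by case: se.
  move=> v; split=> [e|[u <-]]; last by rewrite /= (short_exact_comp0 _ se) linear0.
  by apply: (short_exact_ker se); apply: (can_inj hK); rewrite linear0.
by move=> n; have [v vE] := short_exact_surj se (k n); exists v; rewrite /= vE kK.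
Qed.

(** A stock of modules closed under syzygies over S/(xy): S/(x) and S/(y) are exchanged, S/(xy) has
    syzygy 0, coker A is exchanged with coker (yB), and coker B with coker (yA). Taking [y = 1]
    gives the stock over S/(x). *)
Inductive mf_base x y a b (A : {linear 'rV[S]_a -> 'rV[S]_b})
    (B : {linear 'rV[S]_b -> 'rV[S]_a}) : lmodType S -> Prop :=
| mf_base_x m : mf_base x y A B (free_mod x m)
| mf_base_y m : mf_base x y A B (free_mod y m)
| mf_base_xy m : mf_base x y A B (free_mod (x * y) m)
| mf_base_A : mf_base x y A B (coker A)
| mf_base_B : mf_base x y A B (coker B)
| mf_base_yA : mf_base x y A B (coker (complin (scal y _) A))
| mf_base_yB : mf_base x y A B (coker (complin (scal y _) B)).

Lemma mf_base_killed x y a b (A : {linear 'rV[S]_a -> 'rV[S]_b})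
    (B : {linear 'rV[S]_b -> 'rV[S]_a}) N :
  mf_pair x A B -> mf_base x y A B N -> killed (x * y) N.
Proof.
move=> [AI BI AB BA]; case=> [m|m|m||||]; apply: coker_killed => v.
- by exists (y *: v); rewrite /= scalerA.
- by exists (x *: v); rewrite /= scalerA mulrC.
- by exists v.
- by exists (y *: B v); rewrite linearZ /= AB scalerA mulrC.
- by exists (y *: A v); rewrite linearZ /= BA scalerA mulrC.
- by exists (B v); rewrite /= AB scalerA mulrC.
- by exists (A v); rewrite /= BA scalerA mulrC.
Qed.

(** A cofactor [c] of [f], with [f c = w], presents the syzygy: the kernel of (S/(w))^m -> coker f
    is coker c. *)
Lemma covered_coker w X m V (f : {linear V -> 'rV[S]_m}) (c : {linear 'rV[S]_m -> V}) :
  injective f -> (forall u, w *: u = f (c u)) -> X (free_mod w m) ->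
  built w X 0 (coker c) -> covered w X 0 (coker f).
Proof.
move=> fI wE Xf bc; have [i [p [se _ _]]] := @coker_comp_exact _ _ _ _ (scal w _) f c fI wE.
exists (coker c), (free_mod w m), i, p; split=> //.
- exact: built_base.
- exact: free_mod_killed.
- exact: free_mod_proj.
Qed.

(** Each generator is the cokernel of an injective map that has a cofactor with product xy. In the
    order of the constructors the cofactors are y, x, 1, yB, yA, B, A. *)
Lemma mf_base_covered x y a b (A : {linear 'rV[S]_a -> 'rV[S]_b})
    (B : {linear 'rV[S]_b -> 'rV[S]_a}) N :
  GRing.lreg x -> GRing.lreg y -> mf_pair x A B -> mf_base x y A B N ->
  covered (x * y) (mf_base x y A B) 0 N.
Proof.
move=> rx ry [AI BI AB BA]; have rxy : GRing.lreg (x * y) by exact: lregM.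
case=> [m|m|m||||].
- apply: (@covered_coker _ _ _ _ _ (scal y _)).
  + exact: lreg_scal_inj.
  + by move=> u; rewrite /= scalerA.
  + exact: mf_base_xy.
  + by apply: built_base; exact: mf_base_y.
- apply: (@covered_coker _ _ _ _ _ (scal x _)).
  + exact: lreg_scal_inj.
  + by move=> u; rewrite /= scalerA mulrC.
  + exact: mf_base_xy.
  + by apply: built_base; exact: mf_base_x.
- apply: (@covered_coker _ _ _ _ _ (idlin _)).
  + exact: lreg_scal_inj.
  + by [].
  + exact: mf_base_xy.
  + apply: built_null => c; have [v <-] := coker_proj_surj c.
    by apply/coker_exact; exists v.
- apply: (@covered_coker _ _ _ _ _ (complin (scal y _) B)) => //.
  + by move=> u; rewrite /= linearZ /= AB scalerA mulrC.
  + exact: mf_base_xy.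
  + by apply: built_base; exact: mf_base_yB.
- apply: (@covered_coker _ _ _ _ _ (complin (scal y _) A)) => //.
  + by move=> u; rewrite /= linearZ /= BA scalerA mulrC.
  + exact: mf_base_xy.
  + by apply: built_base; exact: mf_base_yA.
- apply: (@covered_coker _ _ _ _ _ B).
  + by move=> u v /(lreg_scal_inj ry)/AI.
  + by move=> u; rewrite /= AB scalerA mulrC.
  + exact: mf_base_xy.
  + by apply: built_base; exact: mf_base_B.
- apply: (@covered_coker _ _ _ _ _ A).
  + by move=> u v /(lreg_scal_inj ry)/BI.
  + by move=> u; rewrite /= BA scalerA mulrC.
  + exact: mf_base_xy.
  + by apply: built_base; exact: mf_base_A.
Qed.

(** With 1 in place of [y] the stock collapses to S/(x), coker A and coker B, all of which occur for
    every [y]. So a construction over S/(x) can be read over S/(xy). *)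
Lemma mf_base1_built x y a b (A : {linear 'rV[S]_a -> 'rV[S]_b})
    (B : {linear 'rV[S]_b -> 'rV[S]_a}) N :
  mf_pair x A B -> mf_base x 1 A B N -> built (x * y) (mf_base x y A B) 0 N.
Proof.
move=> [AI BI _ _]; case=> [m|m|m||||].
- by apply: built_base; exact: mf_base_x.
- apply: built_null => c; have := free_mod_killed c.
  by rewrite scale1r.
- by rewrite mulr1; apply: built_base; exact: mf_base_x.
- by apply: built_base; exact: mf_base_A.
- by apply: built_base; exact: mf_base_B.
- apply: (@built_isom _ _ _ _ _ (coker A)).
    by apply/isom_sym/coker_eq_isom => // u; rewrite /= scale1r.
  by apply: built_base; exact: mf_base_A.
- apply: (@built_isom _ _ _ _ _ (coker B)).
    by apply/isom_sym/coker_eq_isom => // u; rewrite /= scale1r.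
  by apply: built_base; exact: mf_base_B.
Qed.

(* With B the cofactor of f, multiplication by B embeds coker (y f) into
   (S/(xy))^a as the kernel of the projection to coker B, which is in MF x. *)
Lemma built_coker_scal x y k a b (A : {linear 'rV[S]_a -> 'rV[S]_b})
    (B : {linear 'rV[S]_b -> 'rV[S]_a}) c d M (f : {linear 'rV[S]_c -> 'rV[S]_d})
    (g : {linear 'rV[S]_d -> M}) :
  GRing.lreg x -> GRing.lreg y -> mf_pair x A B ->
  (forall N, MF x N -> built x (mf_base x 1 A B) k N) ->
  killed x M -> short_exact f g ->
  built (x * y) (mf_base x y A B) k (coker (complin (scal y _) f)).
Proof.
move=> rx ry AB bMF kM se.
have [B' fB'] := mf_pair_exists rx kM se; have [fI BI fB Bf] := fB'.
have bC : built (x * y) (mf_base x y A B) k (coker B').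
  apply: built_mono (leqnn k) (bMF _ (mf_pair_MF (mf_pairC fB'))).
    by move=> N; exact: killed_mul.
  by move=> N; exact: mf_base1_built.
have [|i [p [se' _ _]]] :=
  @coker_comp_exact _ _ _ _ (scal (x * y) _) B' (complin (scal y _) f) BI.
  by move=> u; rewrite /= linearZ /= Bf scalerA mulrC.
apply: built_syzygy bC se' _ _ _.
- by move=> N; exact: mf_base_killed.
- by move=> N; exact: mf_base_covered.
- exact: free_mod_killed.
- exact: free_mod_proj.
- by apply: built_base; exact: mf_base_xy.
Qed.

End Factorizations.

Lemma image_exists (R : pzRingType) (U V : lmodType R) (f : {linear U -> V}) :
  exists (N : lmodType R) (i : {linear N -> V}),
    injective i /\ forall v, (exists n, i n = v) <-> (exists u, f u = v).
Proof.
exists (kermod (coker_proj f)), (ker_incl _); split; first exact: ker_incl_inj.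
by move=> v; rewrite -(ker_exact (coker_proj f) v); exact: coker_exact.
Qed.

(** * Additive closures and brackets *)

Section Brackets.
Variable R : pzRingType.
Implicit Types (X Y Z : subcat R) (M N A B E G : lmodType R).

Lemma all_in_cat X s t : all_in X s -> all_in X t -> all_in X (s ++ t).
Proof. by elim: s => //= M s IHs [XM /IHs h] /h. Qed.

Lemma retract_prodA A B E : retract ((A * B) * E)%type (A * (B * E))%type.
Proof.
pose f1 := fstlin (A * B)%type E; pose s1 := sndlin (A * B)%type E.
pose f2 := fstlin A (B * E)%type; pose s2 := sndlin A (B * E)%type.
exists (pairlin (complin (fstlin A B) f1) (pairlin (complin (sndlin A B) f1) s1)).
exists (pairlin (pairlin f2 (complin (fstlin B E) s2)) (complin (sndlin B E) s2)).
by case=> -[].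
Qed.

Lemma retract_cat (s t : seq (lmodType R)) :
  retract (direct_sum s * direct_sum t)%type (direct_sum (s ++ t)).
Proof.
elim: s => [|M s IHs] /=; last first.
  apply: retract_trans (retract_prodA _ _ _) _.
  exact: retract_prod (retract_refl M) IHs.
exists (sndlin _ _), (pairlin (zerolin _ _) (idlin _)) => -[u v] /=.
by congr (_, _); apply/rowP => -[].
Qed.

Lemma isom_direct_complement M N : retract M N ->
  exists K : lmodType R, isom (M * K)%type N.
Proof.
move=> [i [p ip]]; exists (kermod p); apply/isomP.
have [k kE] : exists k : {linear N -> kermod p}, forall n, ker_incl p (k n) = n - i (p n).
  have lin : linear (fun n : N => n - i (p n)).
    by move=> c u v; rewrite (linearP p) (linearP i) opprD scalerBr addrACA.
  apply: (@ker_lift _ _ _ _ (ker_incl p) (mklin lin)); first exact: ker_incl_inj.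
  by move=> n; apply/ker_exact; rewrite /= linearB /= ip subrr.
exists (copairlin i (ker_incl p)), (pairlin p k); split=> [[m u]|n].
  have pu : p (ker_incl p u) = 0 by apply/ker_exact; exists u.
  have e1 : p (i m + ker_incl p u) = m by rewrite linearD /= ip pu addr0.
  congr (_, _); first exact: e1.
  by apply: ker_incl_inj; rewrite kE e1 /= addrC addKr.
have e : i (p n) + ker_incl p (k n) = n by rewrite kE addrC subrK.
exact: e.
Qed.

Lemma add_closureP X M : add_closure X M <->
  exists s, all_in X s /\ retract M (direct_sum s).
Proof.
split=> -[s [Xs]].
  case=> N /isom_retract r; exists s; split=> //.
  exact: retract_trans (retract_prodl M N) r.
by move/isom_direct_complement => h; exists s.
Qed.

Lemma add_closure_mem X M : X M -> add_closure X M.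
Proof.
move=> XM; apply/add_closureP; exists [:: M]; split=> //=.
exact: retract_prodl.
Qed.

Lemma add_closure_prod X M N :
  add_closure X M -> add_closure X N -> add_closure X (M * N)%type.
Proof.
move=> /add_closureP[s [Xs rs]] /add_closureP[t [Xt rt]]; apply/add_closureP.
exists (s ++ t); split; first exact: all_in_cat.
exact: retract_trans (retract_prod rs rt) (retract_cat s t).
Qed.

Lemma add_closure_retract X M N : retract M N -> add_closure X N -> add_closure X M.
Proof.
move=> r /add_closureP[s [Xs rs]]; apply/add_closureP; exists s.
by split=> //; exact: retract_trans rs.
Qed.

Lemma add_closure0 X : add_closure X 'rV[R]_0.
Proof. by apply/add_closureP; exists [::]; split=> //; exact: retract_refl. Qed.

Lemma bracket_mem X M : X M -> bracket X M.
Proof.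
by move=> XM; apply: add_closure_mem; right; exists 0%N, M; split=> //; exact: isom_refl.
Qed.

Lemma bracketS_is_bracket X n : exists Y, bracketS X n = bracket Y.
Proof. by case: n => [|n]; eexists. Qed.

Lemma bracketS_prod X n M N :
  bracketS X n M -> bracketS X n N -> bracketS X n (M * N)%type.
Proof. by have [Y ->] := bracketS_is_bracket X n; exact: add_closure_prod. Qed.

Lemma bracketS_retract X n M N : retract M N -> bracketS X n N -> bracketS X n M.
Proof. by have [Y ->] := bracketS_is_bracket X n; exact: add_closure_retract. Qed.

Lemma bracketS0 X n : bracketS X n 'rV[R]_0.
Proof. by have [Y ->] := bracketS_is_bracket X n; exact: add_closure0. Qed.

Lemma bracketS_ext X n A E B (f : {linear A -> E}) (g : {linear E -> B}) :
  short_exact f g -> bracketS X n A -> bracketS X 0 B -> bracketS X n.+1 E.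
Proof. by move=> se bA bB; apply: bracket_mem; exists A, B, f, g. Qed.

Lemma bracketS_mem X n M : X M -> bracketS X n M.
Proof.
move=> XM; elim: n => [|n IHn]; first exact: bracket_mem.
apply: (bracketS_ext _ IHn (bracketS0 X 0)).
by apply: short_exact_0r => v; apply/rowP => -[].
Qed.

End Brackets.

(** * Passage between S/(x)-modules and S-modules killed by x *)

Section QuotientModules.
Variables (S : comPzRingType) (x : S).
Notation Q := (quotr x).
Notation rs := (restr (quotr_pi x)).
Implicit Types (M N P G : lmodType Q).

Fact quotr_lin_linear M N (f : {linear rs M -> rs N}) : linear (f : M -> N).
Proof. by move=> a u v; have [s <-] := quotr_pi_surj a; exact: (linearP f s). Qed.
Definition quotr_lin M N (f : {linear rs M -> rs N}) : {linear M -> N} :=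
  mklin (quotr_lin_linear f).

Fact restr_lin_linear M N (f : {linear M -> N}) : linear (f : rs M -> rs N).
Proof. by move=> a u v; exact: (linearP f (quotr_pi x a)). Qed.
Definition restr_lin M N (f : {linear M -> N}) : {linear rs M -> rs N} :=
  mklin (restr_lin_linear f).

Lemma quotr_pi_x : quotr_pi x x = 0.
Proof.
have : quotr_pi x x = quotr_pi x 0 by apply/quotr_pi_eq; exists 1; rewrite subr0 mul1r.
by rewrite rmorph0.
Qed.

Lemma restr_killed M : killed x (rs M).
Proof.
by move=> m; exact: etrans (congr1 (fun a => a *: (m : M)) quotr_pi_x) (scale0r _).
Qed.

Fact quotr_mod_lin_linear (M N : lmodType S) (hM : killed x M) (hN : killed x N)
  (f : {linear M -> N}) : linear (f : quotr_mod hM -> quotr_mod hN).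
Proof.
move=> a u v; have [s <-] := quotr_pi_surj a.
rewrite [_ *: u]quotr_scaleE [_ *: (f u : quotr_mod hN)]quotr_scaleE.
exact: (linearP f s).
Qed.
Definition quotr_mod_lin (M N : lmodType S) (hM : killed x M) (hN : killed x N)
  (f : {linear M -> N}) : {linear quotr_mod hM -> quotr_mod hN} :=
  mklin (@quotr_mod_lin_linear M N hM hN f).

Fact from_quotr_mod_linear (M : lmodType S) (hM : killed x M) :
  linear (id : rs (quotr_mod hM) -> M).
Proof.
move=> s u v.
have e : (quotr_scale (quotr_pi x s) (u : quotr_mod hM) : M) = s *: (u : M).
  exact: quotr_scaleE.
exact: (f_equal (fun t : M => t + (v : M)) e).
Qed.
Definition from_quotr_mod (M : lmodType S) (hM : killed x M) :
  {linear rs (quotr_mod hM) -> M} := mklin (@from_quotr_mod_linear M hM).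

Lemma restr_retract M N : retract M N -> retract (rs M) (rs N).
Proof. by case=> i [p ip]; exists (restr_lin i), (restr_lin p). Qed.

(** A surjection between S-modules killed by [x] is, on the same carriers, a surjection of
    S/(x)-modules, so the lift is found over S/(x) and read back over [S]. *)
Lemma restr_projective P : projective P -> proj_killed x (rs P).
Proof.
move=> pP E N g f hE sg; have hN := killed_surj sg hE.
have sg' : surj (quotr_mod_lin hE hN g) := sg.
have [h hEq] := pP _ _ _ (quotr_lin (complin (to_quotr_mod hN : {linear _ -> _}) f)) sg'.
exists (complin (from_quotr_mod hE) (restr_lin h)).
exact: hEq.
Qed.

Lemma projective_regular : projective (Q^o : lmodType Q).
Proof.
move=> M N g f sg; have [e eE] := sg (f 1).
have lin : linear (fun a : Q^o => (a : Q) *: e).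
  by move=> a u v; rewrite scalerDl scalerA.
exists (mklin lin) => a /=.
by rewrite linearZ /= eE -linearZ; congr (f _); exact: mulr1.
Qed.

Lemma fin_gen_regular : fin_gen (Q^o : lmodType Q).
Proof.
exists 1%N, (fun=> 1) => a; exists (fun=> a).
by rewrite big_ord1; exact/esym/mulr1.
Qed.

Lemma fin_gen_cover P : fin_gen P ->
  exists m (q : {linear free_mod x m -> rs P}), surj q.
Proof.
case=> m [g gP]; exists m.
have lin : linear (fun v : 'rV[S]_m => \sum_i v 0 i *: (g i : rs P)).
  move=> a u v; rewrite scaler_sumr -big_split; apply: eq_bigr => i _.
  by rewrite !mxE scalerDl scalerA.
have [q qE] : exists q : {linear free_mod x m -> rs P},
    forall v, q (coker_proj _ v) = mklin lin v.
  apply: coker_lift; first exact: coker_proj_surj.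
  by move=> v /coker_exact[u <-]; rewrite linearZ /= restr_killed.
exists q => p; have [c ->] := gP p.
have [s sE] := choice (fun i => quotr_pi_surj (c i)).
exists (coker_proj _ (\row_i s i)); rewrite qE /=.
by apply: eq_bigr => i _; rewrite mxE -sE.
Qed.

Lemma built_projective X P : (forall m, X (free_mod x m)) ->
  projective P -> fin_gen P -> built x X 0 (rs P).
Proof.
move=> Xf pP /fin_gen_cover[m [q sq]].
have [h hE] := restr_projective pP (idlin (rs P)) (@free_mod_killed _ x m) sq.
apply: (@built_retract _ _ _ _ _ (free_mod x m)); last exact: built_base.
by exists h, q.
Qed.

Lemma restr_short_exact (A B C : lmodType Q) (f : {linear A -> B}) (g : {linear B -> C}) :
  short_exact f g -> short_exact (restr_lin f) (restr_lin g).
Proof. by []. Qed.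

Section BracketBuilt.
Variables (X : subcat S) (Xkilled : forall N : lmodType S, X N -> killed x N)
  (Xcovered : forall N : lmodType S, X N -> covered x X 0 N)
  (Xfree : forall m, X (free_mod x m)).

(** Higher syzygies are reached one at a time: the image of each differential is a syzygy of the
    image of the one below. Allowing any [M] embedded with that image lets the induction apply to
    the image module [N']. *)
Lemma built_resolution k M N (P : proj_resolution N) j (h : {linear M -> P j}) :
  built x X k (rs N) -> injective h ->
  (forall b, (exists m, h m = b) <-> (exists c, pr_diff P j c = b)) ->
  built x X k (rs M).
Proof.
move=> bN; elim: j M h => [|j IHj] M h hI hr.
  have se : short_exact h (pr_aug P).
    by split=> [//|b|]; [rewrite hr; exact: pr_exact0 | exact: pr_aug_surj].
  apply: built_syzygy Xkilled Xcovered bN (restr_short_exact se) _ _ _.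
  - exact: restr_killed.
  - by apply: restr_projective; exact: pr_projective.
  - by apply: built_projective => //; [exact: pr_projective | exact: pr_fin_gen].
have [N' [i [iI iE]]] := image_exists (pr_diff P j).
have [q qE] : exists q : {linear P j.+1 -> N'}, forall c, i (q c) = pr_diff P j c.
  by apply: ker_lift iI _ => c; apply/iE; exists c.
have se : short_exact h q.
  split=> [//|b|n].
    rewrite hr -(@pr_exactS _ _ P j b) -qE; split=> [->|e]; first by rewrite linear0.
    by apply: iI; rewrite linear0.
  have [|c cE] := (iE (i n)).1; first by exists n.
  by exists c; apply: iI; rewrite qE.
apply: built_syzygy Xkilled Xcovered (IHj _ i iI iE) (restr_short_exact se) _ _ _.
- exact: restr_killed.
- by apply: restr_projective; exact: pr_projective.
- by apply: built_projective => //; [exact: pr_projective | exact: pr_fin_gen].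
Qed.

Lemma bracket_built (Y : subcat Q) k M :
  (forall N, Y N -> built x X k (rs N)) -> bracket Y M -> built x X k (rs M).
Proof.
move=> bY /add_closureP[s [sY /restr_retract rM]]; apply: built_retract rM _.
elim: s sY => [_|N s IHs [YN /IHs bs]] /=.
  by apply: built_null => v; apply/rowP => -[].
(* The restriction of a product is compared with the product of the restrictions by maps that do not
   move elements. *)
apply: (@built_retract _ _ _ _ _ (rs N * rs (direct_sum s))%type).
  by exists (pairlin (restr_lin (fstlin _ _)) (restr_lin (sndlin _ _))),
    (copairlin (restr_lin (pairlin (idlin _) (zerolin _ _)))
               (restr_lin (pairlin (zerolin _ _) (idlin _)))) => -[u v];
    congr (_, _); rewrite /= ?addr0 ?add0r.
apply: built_prod bs; case: YN => [/isom_retract/restr_retract r|].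
  apply: built_retract r _; apply: built_le (leq0n k) _.
  exact: built_projective Xfree projective_regular fin_gen_regular.
case=> -[|i] [N' [/bY bN' /=]].
  by move=> /isom_retract/restr_retract r; exact: built_retract r bN'.
move=> [P [h [hI hr]]]; apply: (built_resolution bN' hI) => b.
split=> -[c cE].
  have [d _ dE] : range (pr_diff P i) b by rewrite -hr; exists c.
  by exists d.
have [d _ dE] : range h b by rewrite hr; exists c.
by exists d.
Qed.

(** Closing under syzygies and adding the ring raises no level, because [X] contains the modules
    (S/(x))^m and its members have one-step syzygies. *)
Lemma bracketS_built G k M : built x X 0 (rs G) ->
  bracketS (sing G) k M -> built x X k (rs M).
Proof.
move=> bG.
have bG0 N : bracket (sing G) N -> built x X 0 (rs N).
  apply: bracket_built => {}N /isom_retract/restr_retract r.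
  exact: built_retract r bG.
elim: k M => [|k IHk] M; first exact: bG0.
apply: bracket_built => E [A [B [f [g [/IHk bA /bG0 bB /restr_short_exact se]]]]].
by apply: built_ext se _ bA bB; exact: restr_killed.
Qed.

End BracketBuilt.

Lemma built_bracketS (G : lmodType S) (hG : killed x G) k (M : lmodType S)
    (hM : killed x M) :
  built x (sing G) k M -> bracketS (sing (quotr_mod hG : lmodType Q)) k (quotr_mod hM).
Proof.
have kG (N : lmodType S) : sing G N -> killed x N.
  by move=> /isom_retract r; exact: killed_retract r hG.
have rq (A B : lmodType S) (hA : killed x A) (hB : killed x B) :
    retract A B -> retract (quotr_mod hA : lmodType Q) (quotr_mod hB).
  by case=> i [p ip]; exists (quotr_mod_lin hA hB i), (quotr_mod_lin hB hA p).
(* The proof that [x] kills [M] is part of the type [quotr_mod hM], so the induction ranges over all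
   such proofs. *)
move=> bM; elim: bM hM => {k M}.
- move=> k M [f [g fK gK]] hM; apply: bracketS_mem; exists (quotr_mod_lin hM hG f).
  by exists g.
- move=> k h0; apply: bracketS_retract (bracketS0 _ k).
  by apply: retract_zero => v; apply/rowP => -[].
- move=> k M N bM IHM bN IHN hMN.
  have hM : killed x M := built_killed kG bM.
  have hN : killed x N := built_killed kG bN.
  apply: bracketS_retract (bracketS_prod (IHM hM) (IHN hN)).
  exists (pairlin (quotr_mod_lin hMN hM (fstlin M N)) (quotr_mod_lin hMN hN (sndlin M N))).
  exists (copairlin (quotr_mod_lin hM hMN (pairlin (idlin M) (zerolin M N)))
                    (quotr_mod_lin hN hMN (pairlin (zerolin N M) (idlin N)))).
  by case=> u v; congr (_, _); rewrite /= ?addr0 ?add0r.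
- move=> k M N r bN IHN hM; have hN : killed x N := built_killed kG bN.
  exact: bracketS_retract (rq _ _ hM hN r) (IHN hN).
- move=> k A E B f g se _ bA IHA bB IHB hE.
  have hA : killed x A := built_killed kG bA.
  have hB : killed x B := built_killed kG bB.
  by apply: (@bracketS_ext _ _ _ _ _ _ (quotr_mod_lin hA hE f) (quotr_mod_lin hE hB g) _
    (IHA hA) (IHB hB)).
Qed.

Lemma quotr_mod_restr M (h : killed x (rs M)) : isom M (quotr_mod h).
Proof. by exists (quotr_lin (to_quotr_mod h : {linear _ -> _})), id. Qed.

Lemma quotr_mod_fin_gen (G : lmodType S) (hG : killed x G) :
  fin_gen G -> fin_gen (quotr_mod hG : lmodType Q).
Proof.
case=> n [g gP]; exists n, g => m; have [c cE] := gP m.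
exists (quotr_pi x \o c); rewrite [LHS]cE; apply: eq_bigr => i _.
by rewrite -[LHS](quotr_scaleE (Mx := hG)).
Qed.

End QuotientModules.

(** * Embedding an iterated extension into a direct sum *)

Section Embedding.
Variable S : comPzRingType.
Implicit Types (w x y z r t : S) (X Y : subcat S) (E M N P T U V F : lmodType S).

(** The equivalence [hG] is used in both directions: [G] lies in its own bracket, hence in MF(x),
    and so is the cokernel of one half of a matrix factorization of [x]. *)
Lemma MF_built x k (G : lmodType (quotr x)) : GRing.lreg x ->
  (forall M : lmodType (quotr x), over_quotr x (MF x) M <-> bracketS (sing G) k M) ->
  exists a b (A : {linear 'rV[S]_a -> 'rV[S]_b}) (B : {linear 'rV[S]_b -> 'rV[S]_a}),
    mf_pair x A B /\ forall N, MF x N -> built x (mf_base x 1 A B) k N.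
Proof.
move=> rx hG; have [kG [a [b [A [g se]]]]] : over_quotr x (MF x) G.
  by apply/hG; apply: bracketS_mem; exact: isom_refl.
have [B AB] := mf_pair_exists rx kG se; exists a, b, A, B; split=> // N mN.
have hN : killed x N by case: mN.
have iN := restr_quotr_mod hN.
have /hG bN : over_quotr x (MF x) (quotr_mod hN) := MF_isom iN mN.
apply: built_isom iN _; apply: bracketS_built bN.
- by move=> N' /(mf_base_killed AB); rewrite mulr1.
- by move=> N' /(mf_base_covered rx (@lreg1 S) AB); rewrite mulr1.
- by move=> m; exact: mf_base_x.
- apply: (built_isom (isom_sym (coker_isom se))).
  by apply: built_base; exact: mf_base_A.
Qed.

Lemma lreg_divl z t : GRing.lreg (z * t) -> GRing.lreg t.
Proof. by move=> r u v e; apply: r; rewrite -!mulrA e. Qed.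

Definition short_resolution M : Prop :=
  exists (P Q : lmodType S) (j : {linear P -> Q}) (q : {linear Q -> M}),
    [/\ projective P, projective Q & short_exact j q].

(** Projective dimension at most 1 passes to extensions: the kernel in the horseshoe lemma is an
    extension of projectives, hence projective. *)
Lemma bigstar_resolution n (x : 'I_n.+1 -> S) M :
  bigstar (fun i => MF (x i)) M -> short_resolution M.
Proof.
have resMF z N : MF z N -> short_resolution N.
  move=> [_ [a [b [f [g se]]]]]; exists 'rV[S]_a, 'rV[S]_b, f, g.
  by split=> //; exact: projective_rV.
elim: n x M => [|n IHn] x M /=; first exact: resMF.
case=> [A] [B] [f] [g] [/resMF[P [Q [j [q [pP pQ se]]]]]].
move=> /IHn[P' [Q' [j' [q' [pP' pQ' se']]]]] seM.
have [l lE] := pQ' _ _ g q' (short_exact_surj seM).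
have [K [i [p [u [v [seK seP]]]]]] := horseshoe seM se se' lE.
exists K, (Q * Q')%type, i, p; split=> //.
  exact: projective_ext seP pP pP'.
exact: projective_prod.
Qed.

(** For [F] killed by [y], this is the vanishing of Ext^1 over S/(y) of [F] by (S/(y))^b, in the
    form that [embed_step] applies. *)
Definition extends y b F : Prop :=
  forall V T (i : {linear V -> T}) (q : {linear T -> F}) (h : {linear V -> free_mod y b}),
    short_exact i q -> killed y T ->
    exists h' : {linear T -> free_mod y b}, forall v, h' (i v) = h v.

(* Ext^1(S/(z), S/(y)) vanishes over S/(y) when z divides the regular element y. *)
Lemma extends_free y b z t m : GRing.lreg y -> z * t = y ->
  extends y b (free_mod z m).
Proof.
move=> ry zt V T i q h se kT.
have rt : GRing.lreg t by apply: (@lreg_divl z); rewrite zt.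
have rz : GRing.lreg z by apply: (@lreg_divl t); rewrite mulrC zt.
have [s sE] := projective_rV (coker_proj (scal z 'rV[S]_m)) (short_exact_surj se).
have [u uE] : exists u : {linear 'rV[S]_m -> V}, forall e, i (u e) = z *: s e.
  apply: (@ker_lift _ _ _ _ i (complin (scal z T) s)); first by case: se.
  move=> e; apply: (short_exact_ker se).
  by rewrite /= linearZ /= sE -linearZ; apply/coker_exact; exists e.
have [c cE] := projective_rV (complin h u) (@coker_proj_surj _ _ _ (scal y 'rV[S]_b)).
(* Since [u (t *: e)] maps to [y *: s e = 0] in [T], the vector [t *: c e] lies in y S^b = t z S^b;
   cancelling [t] makes [c e] divisible by [z]. *)
have [d dE] : exists d : {linear 'rV[S]_m -> 'rV[S]_b}, forall e, z *: d e = c e.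
  apply: (@ker_lift _ _ _ _ (scal z 'rV[S]_b) c); first exact: lreg_scal_inj.
  move=> e; have /coker_exact[v vE] : coker_proj (scal y 'rV[S]_b) (t *: c e) = 0.
    rewrite linearZZ cE -linearZZ /=.
    suff -> : u (t *: e) = 0 by rewrite linear0.
    apply: (short_exact_inj se).
    by rewrite uE linear0 linearZ /= scalerA zt kT.
  exists v; apply: (lreg_scal_inj rt).
  by rewrite /= scalerA mulrC zt -vE.
(* [T] is the quotient of V + S^m by the pairs (-u e', z e'), on which [h] and the reduction of [d]
   cancel. *)
have [h' h'E] : exists h' : {linear T -> free_mod y b},
    forall v, h' (copairlin i s v) = copairlin h (complin (coker_proj _) d) v.
  apply: coker_lift.
    move=> x; have [e eE] := coker_proj_surj (q x).
    have [v vE] : exists v, i v = x - s e.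
      by apply: (short_exact_ker se); rewrite linearB /= sE eE subrr.
    by exists (v, e); rewrite /= vE subrK.
  case=> v e /= ve.
  have /coker_exact[e' e'E] : coker_proj (scal z 'rV[S]_m) e = 0.
    have : q (i v + s e) = 0 by rewrite ve linear0.
    by rewrite linearD /= (short_exact_comp0 _ se) add0r sE.
  have vE : v = - u e'.
    apply: (short_exact_inj se); rewrite linearN /= uE -linearZ.
    by apply/eqP; rewrite -addr_eq0 e'E ve.
  have -> : d e = c e' by rewrite -dE -linearZZ -[in LHS]e'E.
  change (h v + coker_proj (scal y 'rV[S]_b) (c e') = 0).
  by rewrite cE vE linearN addNr.
exists h' => v.
have : h' (i v + s 0) = h v + coker_proj _ (d 0) := h'E (v, 0).
by rewrite !linear0 !addr0.
Qed.

Lemma extends_zero y b : extends y b 'rV[S]_0.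
Proof.
move=> V T i q h se kT; apply: coker_lift => [t|v].
  by apply: (short_exact_ker se); exact: zero_rV0.
by rewrite -(linear0 i) => /(short_exact_inj se) ->; rewrite linear0.
Qed.

(** Extend first to the preimage of [F] in [T], then across the remaining quotient [F']. *)
Lemma extends_prod y b F F' :
  extends y b F -> extends y b F' -> extends y b (F * F')%type.
Proof.
move=> xF xF' V T i q h se kT.
pose q2 := complin (sndlin F F') q.
have [T1 [j [jI jE]]] : exists T1 (j : {linear T1 -> T}), injective j /\ exact_at j q2.
  by exists (kermod q2), (ker_incl q2); split; [exact: ker_incl_inj | exact: ker_exact].
have [u uE] : exists u : {linear V -> T1}, forall v, j (u v) = i v.
  by apply: ker_lift jI _ => v; apply/jE; rewrite /= (short_exact_comp0 _ se).
have se1 : short_exact u (complin (complin (fstlin F F') q) j).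
  split=> [v v' e|x|f].
  - by apply: (short_exact_inj se); rewrite -!uE e.
  - split=> [x1|[v <-]]; last by rewrite /= uE (short_exact_comp0 _ se).
    have x2 : q2 (j x) = 0 by apply/jE; exists x.
    have [v vE] : exists v, i v = j x.
      by apply: (short_exact_ker se); move: x1 x2 => /=; case: (q (j x)) => c d /= -> ->.
    by exists v; apply: jI; rewrite uE.
  - have [x xE] := short_exact_surj se (f, 0).
    have [x1 x1E] : exists x1 : T1, j x1 = x by apply/jE; rewrite /= xE.
    by exists x1; rewrite /= x1E xE.
have se2 : short_exact j q2.
  split=> // f; have [x xE] := short_exact_surj se (0, f).
  by exists x; rewrite /= xE.
have [h1 h1E] := xF _ _ _ _ h se1 (killed_inj jI kT).
have [h2 h2E] := xF' _ _ _ _ h1 se2 kT.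
by exists h2 => v; rewrite -uE h2E.
Qed.

Inductive free_sum (L : seq S) : lmodType S -> Prop :=
| free_sum_zero : free_sum L 'rV[S]_0
| free_sum_free z m : z \in L -> free_sum L (free_mod z m)
| free_sum_prod F F' : free_sum L F -> free_sum L F' -> free_sum L (F * F')%type.

Lemma free_sum_mono L L' F : {subset L <= L'} -> free_sum L F -> free_sum L' F.
Proof.
move=> sL; elim=> {F} [|z m /sL zL|F F' _ f _ f'].
- exact: free_sum_zero.
- exact: free_sum_free.
- exact: free_sum_prod.
Qed.

Lemma free_sum_extends y b L F : GRing.lreg y ->
  (forall z, z \in L -> exists t, z * t = y) -> free_sum L F -> extends y b F.
Proof.
move=> ry yL; elim=> {F} [|z m /yL[t zt]|F F' _ xF _ xF'].
- exact: extends_zero.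
- exact: extends_free zt.
- exact: extends_prod.
Qed.

(** When z t = r, the kernel of S/(r) -> S/(z) is S/(t), whence the condition on the modules
    (S/(t))^m. *)
Lemma free_sum_covered r L X F : GRing.lreg r ->
  (forall z, z \in L -> exists2 t, z * t = r & forall m, built r X 0 (free_mod t m)) ->
  (forall m, X (free_mod r m)) -> free_sum L F -> covered r X 0 F.
Proof.
move=> rr rL Xr; elim=> {F} [|z m /rL[t zt bt]|F F' _ cF _ cF'].
- exact: covered_zero.
- apply: (covered_coker (c := scal t _) _ _ (Xr m) (bt m)).
    by apply: lreg_scal_inj; apply: (@lreg_divl t); rewrite mulrC zt.
  by move=> u; rewrite /= scalerA zt.
- exact: covered_prod cF cF'.
Qed.

(* W = coker (y f) contains the cokernel N of f as yW, with W/N = (S/(y))^b.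
   Since y kills the extension class of M in Ext^1(V, S^b), the inclusion of N
   in W extends to M. *)
Lemma embed_step y a b (f : {linear 'rV[S]_a -> 'rV[S]_b}) N M V T F
    (g : {linear 'rV[S]_b -> N}) (i : {linear N -> M}) (p : {linear M -> V})
    (u : {linear V -> T}) (q : {linear T -> F}) :
  GRing.lreg y -> short_exact f g -> short_exact i p -> short_exact u q ->
  short_resolution V -> killed y V -> killed y T -> extends y b F ->
  exists (i' : {linear M -> (coker (complin (scal y _) f) * T)%type})
    (q' : {linear (coker (complin (scal y _) f) * T)%type -> (free_mod y b * F)%type}),
    short_exact i' q'.
Proof.
move=> ry seN seM seT [P [Q [j [c [pP pQ seV]]]]] kV kT xF.
pose yf := complin (scal y _) f.
have [m mE] : exists m : {linear N -> coker yf},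
    forall v, m (g v) = coker_proj yf (y *: v).
  apply: (@coker_lift _ _ _ _ g (complin (coker_proj yf) (scal y _))).
    exact: short_exact_surj seN.
  by move=> v /(short_exact_ker seN)[w <-]; apply/coker_exact; exists w.
have mI : injective m.
  apply: inj0 => n; have [v <-] := short_exact_surj seN n; rewrite mE.
  case/coker_exact=> w /(lreg_scal_inj ry) <-; exact: short_exact_comp0 seN.
have [k kE] : exists k : {linear coker yf -> free_mod y b},
    forall v, k (coker_proj yf v) = coker_proj _ v.
  apply: (@coker_lift _ _ _ _ _ (coker_proj (scal y _))); first exact: coker_proj_surj.
  by move=> v /coker_exact[w <-]; apply/coker_exact; exists (f w).
have km (w : coker yf) : k w = 0 <-> exists n, m n = w.
  have [v <-] := coker_proj_surj w; rewrite kE; split=> [/coker_exact[v' <-]|[n]].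
    by exists (g v'); rewrite mE.
  have [v' <-] := short_exact_surj seN n; rewrite mE => /esym e.
  by rewrite -kE e kE; apply/coker_exact; exists v'.
have [s sE] := pQ _ _ p c (short_exact_surj seM).
(* [d] represents the class of [M] in Ext^1(V, N), and [d'] lifts it to S^b. As [y] kills [V],
   multiplication by [y] on the resolution is null-homotopic via [e]: y d' = d' e j, which extends
   over [Q]. *)
have [d dE] : exists d : {linear P -> N}, forall e, i (d e) = s (j e).
  apply: (@ker_lift _ _ _ _ i (complin s j)); first by case: seM.
  by move=> e; apply: (short_exact_ker seM); rewrite /= sE (short_exact_comp0 _ seV).
have [d' d'E] := pP _ _ g d (short_exact_surj seN).
have [e eE] : exists e : {linear Q -> P}, forall v, j (e v) = y *: v.
  apply: (@ker_lift _ _ _ _ j (scal y Q)); first by case: seV.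
  by move=> v; apply: (short_exact_ker seV); rewrite /= linearZ /= kV.
have [n nE] : exists n : {linear M -> coker yf}, forall v,
    n (copairlin i s v) = copairlin m (complin (coker_proj yf) (complin d' e)) v.
  apply: coker_lift.
    move=> x; have [v vE] := short_exact_surj seV (p x).
    have [l lE] : exists l, i l = x - s v.
      by apply: (short_exact_ker seM); rewrite linearB /= sE vE subrr.
    by exists (l, v); rewrite /= lE subrK.
  case=> l v /= lv.
  have [t tE] : exists t : P, j t = v.
    apply: (short_exact_ker seV); rewrite -sE.
    have : p (i l + s v) = 0 by rewrite lv linear0.
    by rewrite linearD /= (short_exact_comp0 _ seM) add0r.
  have lE : l = - d t.
    apply: (short_exact_inj seM); rewrite linearN /= dE tE.
    by apply/eqP; rewrite -addr_eq0 lv.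
  have ev : e v = y *: t.
    by apply: (short_exact_inj seV); rewrite eE -tE linearZ.
  rewrite ev; change (m l + coker_proj yf (d' (y *: t)) = 0).
  by rewrite lE linearN linearZZ -d'E mE addNr.
have nm l : n (i l) = m l.
  have : n (i l + s 0) = m l + coker_proj _ (d' (e 0)) := nE (l, 0).
  by rewrite !linear0 !addr0.
(* The composite k n vanishes on [N], so it factors through [V]; the sign makes k + h vanish on the
   image of [M] once [h0] is extended to [h] on [T]. *)
have [h0 h0E] : exists h0 : {linear V -> free_mod y b}, forall x : M, h0 (p x) = - k (n x).
  apply: (@coker_lift _ _ _ _ p (opplin (complin k n))).
    exact: short_exact_surj seM.
  move=> x /(short_exact_ker seM)[l <-].
  by apply/eqP; rewrite /= nm oppr_eq0; apply/eqP/km; exists l.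
have [h hE] := xF _ _ _ _ h0 seT kT.
exists (pairlin n (complin u p)), (pairlin (copairlin k h) (complin q (sndlin _ _))).
split.
- apply: inj0 => x [nx /= ux].
  have px : p x = 0 by apply: (short_exact_inj seT); rewrite linear0.
  have [l lx] := short_exact_ker seM px.
  have l0 : l = 0 by apply: mI; rewrite linear0 -nm lx.
  by rewrite -lx l0 linear0.
- case=> w t; split=> [[/= kh qt]|[x [<- <-]]]; last first.
    by rewrite /= hE h0E subrr (short_exact_comp0 _ seT).
  have [v vE] := short_exact_ker seT qt.
  have [x xE] := short_exact_surj seM v.
  have [l lE] : exists l, m l = w - n x.
    apply/km; rewrite linearB /=; apply/eqP.
    by rewrite -h0E xE -hE vE; apply/eqP.
  exists (x + i l); rewrite /= !linearD /= nm lE addrC subrK.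
  by rewrite (short_exact_comp0 _ seM) linear0 addr0 xE vE.
- case=> w t; have [x xE] := short_exact_surj seT t.
  have [v vE] := coker_proj_surj (w - h x).
  by exists (coker_proj yf v, x); rewrite /= kE vE subrK xE.
Qed.

End Embedding.

(** * One generator in place of several *)

Section SingleGenerator.
Variable S : comPzRingType.
Implicit Types (w x y z r t : S) (X Y : subcat S) (M N G : lmodType S).

Lemma fin_gen_image (R : pzRingType) (M : lmodType R) m (q : {linear 'rV[R]_m -> M}) :
  surj q -> fin_gen M.
Proof.
move=> sq; exists m, (fun i => q (delta_mx 0 i)) => v.
have [u <-] := sq v; exists (fun i => u 0 i).
by rewrite [u in LHS]row_sum_delta linear_sum; apply: eq_bigr => i _; rewrite linearZZ.
Qed.

Lemma fin_gen_prod (R : pzRingType) (M N : lmodType R) :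
  fin_gen M -> fin_gen N -> fin_gen (M * N)%type.
Proof.
move=> [m [g gP]] [n [h hP]].
exists (m + n)%N, (fun i => match split i with inl j => (g j, 0) | inr j => (0, h j) end).
case=> u v; have [c cE] := gP u; have [d dE] := hP v.
exists (fun i => match split i with inl j => c j | inr j => d j end).
rewrite big_split_ord /=.
under eq_bigr => i _ do rewrite (unsplitK (inl i)).
under [X in _ = _ + X]eq_bigr => i _ do rewrite (unsplitK (inr i)).
have -> : \sum_i c i *: ((g i, 0) : (M * N)%type) = (u, 0).
  transitivity (pairlin (idlin M) (zerolin M N) u) => //; rewrite cE linear_sum.
  by apply: eq_bigr => i _; rewrite linearZZ.
have -> : \sum_i d i *: ((0, h i) : (M * N)%type) = (0, v).
  transitivity (pairlin (zerolin N M) (idlin N) v) => //; rewrite dE linear_sum.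
  by apply: eq_bigr => i _; rewrite linearZZ.
by rewrite /GRing.add /= /add_pair /= addr0 add0r.
Qed.

Lemma fin_gen_coker (U : lmodType S) m (f : {linear U -> 'rV[S]_m}) : fin_gen (coker f).
Proof. exact: fin_gen_image (@coker_proj_surj _ _ _ f). Qed.

(** The radius asks for a single module. Finitely many generators are replaced by their direct sum,
    and the unbounded family (S/(z))^m by S/(z). *)
Definition one_generated r X : Prop :=
  exists G, [/\ fin_gen G, killed r G & forall N, X N -> built r (sing G) 0 N].

Lemma one_generated_sub r X Y : (forall N, X N -> Y N) ->
  one_generated r Y -> one_generated r X.
Proof. by move=> XY [G [fG kG bG]]; exists G; split=> // N /XY/bG. Qed.

Lemma one_generated_mul r s X : one_generated r X -> one_generated (r * s) X.
Proof.
move=> [G [fG kG bG]]; exists G; split=> //; first exact: killed_mul.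
move=> N /bG; apply: built_mono => // M; first exact: killed_mul.
by move=> GM; exact: built_base.
Qed.

Lemma one_generated_module r G : fin_gen G -> killed r G ->
  one_generated r (fun N => N = G).
Proof.
by move=> fG kG; exists G; split=> // N ->; apply: built_base; exact: isom_refl.
Qed.

Lemma one_generated_or r X Y : one_generated r X -> one_generated r Y ->
  one_generated r (fun N => X N \/ Y N).
Proof.
move=> [G [fG kG bG]] [H [fH kH bH]]; exists (G * H)%type; split.
- exact: fin_gen_prod.
- exact: killed_prod.
- have bGH : built r (sing (G * H : lmodType S)%type) 0 (G * H)%type.
    by apply: built_base; exact: isom_refl.
  move=> N [/bG|/bH]; apply: built_mono => // M /isom_retract rM.
    exact: built_retract rM (built_retract (retract_prodl _ _) bGH).
  exact: built_retract rM (built_retract (retract_prodr _ _) bGH).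
Qed.

Lemma free_mod_map w m n (f : {linear 'rV[S]_m -> 'rV[S]_n}) :
  exists f' : {linear free_mod w m -> free_mod w n},
    forall v, f' (coker_proj _ v) = coker_proj _ (f v).
Proof.
apply: (@coker_lift _ _ _ _ _ (complin (coker_proj _) f)); first exact: coker_proj_surj.
by move=> v /coker_exact[u <-]; apply/coker_exact; exists (f u); rewrite /= linearZZ.
Qed.

Lemma free_mod_retract w m n :
  retract (free_mod w (m + n)) (free_mod w m * free_mod w n)%type.
Proof.
have ll : linear (@lsubmx S 1 m n) by move=> a u v; rewrite linearP.
have lr : linear (@rsubmx S 1 m n) by move=> a u v; rewrite linearP.
have jl : linear (fun u : 'rV[S]_m => row_mx u (0 : 'rV[S]_n)).
  by move=> a u v; rewrite scale_row_mx add_row_mx scaler0 addr0.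
have jr : linear (fun v : 'rV[S]_n => row_mx (0 : 'rV[S]_m) v).
  by move=> a u v; rewrite scale_row_mx add_row_mx scaler0 addr0.
have [f1 f1E] := free_mod_map w (mklin ll).
have [f2 f2E] := free_mod_map w (mklin lr).
have [g1 g1E] := free_mod_map w (mklin jl).
have [g2 g2E] := free_mod_map w (mklin jr).
exists (pairlin f1 f2), (copairlin g1 g2) => c.
have [v <-] := coker_proj_surj c.
change (g1 (f1 (coker_proj _ v)) + g2 (f2 (coker_proj _ v)) = coker_proj _ v).
rewrite f1E f2E g1E g2E -linearD; congr (coker_proj _ _).
by rewrite /= add_row_mx addr0 add0r hsubmxK.
Qed.

Lemma built_free_mod r X w m : built r X 0 (free_mod w 1) -> built r X 0 (free_mod w m).
Proof.
move=> b1; elim: m => [|m IHm].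
  apply: built_null => c; have [v <-] := coker_proj_surj c.
  by rewrite (zero_rV0 v) linear0.
by apply: (built_retract (free_mod_retract w 1 m)); exact: built_prod.
Qed.

Lemma one_generated_free r z t : z * t = r ->
  one_generated r (fun N => exists m, N = free_mod z m).
Proof.
move=> zt; exists (free_mod z 1); split.
- exact: fin_gen_coker.
- by rewrite -zt; apply: killed_mul; exact: free_mod_killed.
- move=> N [m ->]; apply: built_free_mod; apply: built_base; exact: isom_refl.
Qed.

Lemma one_generated_frees r (L : seq S) : (forall z, z \in L -> exists t, z * t = r) ->
  one_generated r (fun N => exists z m, z \in L /\ N = free_mod z m).
Proof.
elim: L => [_|z L IHL zL].
  exists 'rV[S]_0; split=> [|v|N [z [m []]] //]; last by rewrite (zero_rV0 v) scaler0.
  by apply: (fin_gen_image (q := idlin 'rV[S]_0)) => v; exists v.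
have [t zt] : exists t, z * t = r by apply: zL; rewrite mem_head.
have hL : one_generated r (fun N => exists z m, z \in L /\ N = free_mod z m).
  by apply: IHL => y yL; apply: zL; rewrite inE yL orbT.
apply: one_generated_sub (one_generated_or (one_generated_free zt) hL).
move=> N [y [m []]]; rewrite inE => /orP[/eqP -> ->|yL ->]; first by left; exists m.
by right; exists y, m.
Qed.

Lemma one_generated_mf_base x y a b (A : {linear 'rV[S]_a -> 'rV[S]_b})
    (B : {linear 'rV[S]_b -> 'rV[S]_a}) :
  mf_pair x A B -> one_generated (x * y) (mf_base x y A B).
Proof.
move=> AB; have k N := mf_base_killed (y := y) (N := N) AB.
pose c := one_generated_module (fin_gen_coker _) (k _ _).
apply: one_generated_sub
  (one_generated_or (one_generated_free (erefl (x * y)))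
  (one_generated_or (one_generated_free (mulrC y x))
  (one_generated_or (one_generated_free (mulr1 (x * y)))
  (one_generated_or (c _ _ _ (mf_base_A x y A B))
  (one_generated_or (c _ _ _ (mf_base_B x y A B))
  (one_generated_or (c _ _ _ (mf_base_yA x y A B))
                    (c _ _ _ (mf_base_yB x y A B)))))))).
move=> N [m|m|m||||]; [left|right; left|do 2 right; left|do 3 right; left
  |do 4 right; left|do 5 right; left|do 6 right] => //; by exists m.
Qed.

End SingleGenerator.

(** * The radius bound for iterated extensions *)

Section Radius.
Variable S : comPzRingType.
Implicit Types (M N T F : lmodType S).

Lemma lreg_prod n (x : 'I_n -> S) : (forall i, GRing.lreg (x i)) ->
  GRing.lreg (\prod_i x i).
Proof.
move=> hx; apply: big_ind => [|u v|i _]; [exact: lreg1 | exact: lregM | exact: hx].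
Qed.

Definition mf_built (x : S) k : Prop :=
  exists a b (A : {linear 'rV[S]_a -> 'rV[S]_b}) (B : {linear 'rV[S]_b -> 'rV[S]_a}),
    mf_pair x A B /\ forall N, MF x N -> built x (mf_base x 1 A B) k N.

(** [X] and [L] are fixed before [M]: ranks in [T] and [F] vary with [M], but the generators of [T]
    and the divisors in [F] do not, as a common generator [G] requires. *)
Lemma bigstar_embedding k n (x : 'I_n.+1 -> S) :
  (forall i, GRing.lreg (x i)) -> (forall i, mf_built (x i) k) ->
  exists (X : subcat S) (L : seq S),
    [/\ one_generated (\prod_i x i) X, forall N, X N -> killed (\prod_i x i) N,
        forall z, z \in L -> exists t, z * t = \prod_i x i
      & forall M, bigstar (fun i => MF (x i)) M ->
        exists T F (i : {linear M -> T}) (q : {linear T -> F}),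
          [/\ short_exact i q, killed (\prod_i x i) T, built (\prod_i x i) X k T
            & free_sum L F]].
Proof.
elim: n x => [|n IHn] x hx mx.
  have [a [b [A [B [AB bMF]]]]] := mx ord0.
  have -> : \prod_(i < 1) x i = x ord0 * 1 by rewrite big_ord1 mulr1.
  exists (mf_base (x ord0) 1 A B), [::]; split=> //.
  - exact: one_generated_mf_base.
  - by move=> N; exact: mf_base_killed.
  move=> M /= mM; exists M, 'rV[S]_0, (idlin M), (zerolin _ _); split.
  - by apply: short_exact_0r; exact: zero_rV0.
  - by rewrite mulr1; case: mM.
  - by rewrite mulr1; exact: bMF.
  - exact: free_sum_zero.
have [X [L [gX kX hL hX]]] := IHn _ (fun i => hx (lift ord0 i)) (fun i => mx (lift ord0 i)).
have [a [b [A [B [AB bMF]]]]] := mx ord0.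
rewrite big_ord_recl; set x0 := x ord0.
set y := \prod_(i < n.+1) x (lift ord0 i) in gX kX hL hX *.
have ry : GRing.lreg y by apply: lreg_prod => i; exact: hx.
have kXm N : X N \/ mf_base x0 y A B N -> killed (x0 * y) N.
  case=> [/kX kN|]; last exact: mf_base_killed.
  by rewrite mulrC; exact: killed_mul.
(* [y] joins the divisors because [embed_step] adds a summand (S/(y))^d to the cokernel. *)
exists (fun N => X N \/ mf_base x0 y A B N), (y :: L); split=> //.
- apply: one_generated_or; last exact: one_generated_mf_base.
  by rewrite mulrC; exact: one_generated_mul.
- move=> z; rewrite inE => /orP[/eqP ->|/hL[t zt]]; first by exists x0; rewrite mulrC.
  by exists (t * x0); rewrite mulrA zt mulrC.
move=> M [N [V [i [p [[kN [c [d [f [g seN]]]]] sV seM]]]]].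
have [T [F [u [q [seT kT bT fF]]]]] := hX V sV.
have [i' [q' se']] := embed_step ry seN seM seT (bigstar_resolution sV)
  (bigstar_MF_ann sV) kT (free_sum_extends ry hL fF).
have bW : built (x0 * y) (fun N => X N \/ mf_base x0 y A B N) k
    (coker (complin (scal y _) f)).
  apply: (built_mono _ _ (leqnn k)) (built_coker_scal (hx ord0) ry AB bMF kN seN) => //.
  by move=> N' mN'; apply: built_base; right.
have bT' : built (x0 * y) (fun N => X N \/ mf_base x0 y A B N) k T.
  apply: (built_mono _ _ (leqnn k)) bT => N'.
    by move=> kN'; rewrite mulrC; exact: killed_mul.
  by move=> XN'; apply: built_base; left.
have bWT := built_prod bW bT'.
exists (coker (complin (scal y _) f) * T)%type, (free_mod y d * F)%type, i', q'; split=> //.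
- exact: built_killed kXm bWT.
- apply: free_sum_prod; first by apply: free_sum_free; rewrite mem_head.
  by apply: free_sum_mono fF => z zL; rewrite inE zL orbT.
Qed.

Lemma bigstar_built k n (x : 'I_n.+1 -> S) :
  (forall i, GRing.lreg (x i)) -> (forall i, mf_built (x i) k) ->
  exists G : lmodType S, [/\ fin_gen G, killed (\prod_i x i) G
    & forall M, bigstar (fun i => MF (x i)) M -> built (\prod_i x i) (sing G) k.+1 M].
Proof.
move=> hx mx; have [X [L [gX kX hL hX]]] := bigstar_embedding hx mx.
have rr := lreg_prod hx; set r := \prod_i x i in gX kX hL hX rr *.
have [t tE] : exists t : S -> S, forall z, z \in L -> z * t z = r.
  (* The value 0 outside [L] is a default that makes [t] total. *)
  have /choice[t tE] (z : S) : exists t, z \in L -> z * t = r.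
    by case: (boolP (z \in L)) => [/hL[t zt]|_]; [exists t | exists 0].
  by exists t.
(* S/(r) supplies the covers of the summands of [F], and S/(t z) the syzygy of S/(z). *)
pose L' := r :: map t L.
have hL' z : z \in L' -> exists t, z * t = r.
  rewrite inE => /orP[/eqP ->|/mapP[z' /tE zt ->]]; first by exists 1; rewrite mulr1.
  by exists z'; rewrite mulrC.
pose Y N := X N \/ exists z m, z \in L' /\ N = free_mod z m.
have kY N : Y N -> killed r N.
  case=> [/kX //|[z [m [/hL'[s <-] ->]]]]; apply: killed_mul.
  exact: free_mod_killed.
have [G [fG kG bG]] := one_generated_or gX (one_generated_frees hL').
exists G; split=> // M /hX[T [F [i [q [se kT bT fF]]]]].
have bT' : built r Y k T.
  by apply: (built_mono _ _ (leqnn k)) bT => // N XN; apply: built_base; left.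
have cF : covered r Y 0 F.
  apply: free_sum_covered fF => // [z zL|m]; last by right; exists r, m; rewrite mem_head.
  exists (t z); first exact: tE.
  move=> m; apply: built_base; right; exists (t z), m.
  by rewrite inE map_f ?orbT.
by apply: (built_mono _ _ (leqnn k.+1)) (built_subobject kY se kT bT' cF) => // N /bG.
Qed.

End Radius.

(** * Attained suprema and infima, and the final inequality *)

Lemma ereal_sup_max (A : set (\bar rat)) m : A m -> (forall a, A a -> (a <= m)%E) ->
  ereal_sup A = m.
Proof.
move=> Am ubm; apply: le_anti; rewrite ge_ereal_sup //=.
apply: (ge_supremum_Nmem _ _ Am); exists m; split=> [a Aa|u uA]; [exact: ubm | exact: uA].
Qed.

Lemma ereal_inf_min (A : set (\bar rat)) m : A m -> (forall a, A a -> (m <= a)%E) ->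
  ereal_inf A = m.
Proof.
move=> Am lbm; rewrite /ereal_inf (@ereal_sup_max _ (- m)%E) ?oppeK //.
  by exists m.
by move=> _ [a Aa <-]; rewrite leeN2; exact: lbm.
Qed.

Lemma ereal_inf_nat (A : set nat) :
  ereal_inf [set (n%:R : rat)%:E | n in A] = +oo%E /\ (forall n, ~ A n) \/
  exists m, [/\ ereal_inf [set (n%:R : rat)%:E | n in A] = m%:R%:E, A m
              & forall n, A n -> (m <= n)%N].
Proof.
have [[n An]|A0] := pselect (exists n, A n); last first.
  left; have A0' n : ~ A n by move=> An; apply: A0; exists n.
  split=> //; rewrite (_ : [set (n%:R : rat)%:E | n in A] = set0)%classic ?ereal_inf0 //.
  by apply/seteqP; split=> // a [n An _]; case: (A0' n An).
right; have exA : exists n, `[< A n >] by exists n; apply/asboolP.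
case: (ex_minnP exA) => m /asboolP Am mmin; exists m; split=> //; last first.
  by move=> k /asboolP/mmin.
apply: ereal_inf_min; first by exists m.
by move=> _ [k /asboolP/mmin mk <-]; rewrite lee_fin ler_nat.
Qed.

Theorem theorem1p1 (S : comPzRingType) (hS : noetherian S)
  (n : nat) (x : 'I_n.+1 -> S) (hx : forall i, GRing.lreg (x i)) :
  (subcat_radius (over_quotr (\prod_i x i)%R (bigstar (fun i => MF (x i))))
    <= ereal_sup (range (fun i => subcat_dim (over_quotr (x i) (MF (x i))))) + 1)%E.
Proof.
set dim := fun i => subcat_dim (over_quotr (x i) (MF (x i))).
(* One infinite dimension makes the right-hand side infinite; otherwise each dimension is a natural
   number attained by some [G]. *)
have [[i0 dimy]|fin] := pselect (exists i, dim i = +oo%E).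
  have -> : ereal_sup (range dim) = +oo%E.
    by apply: ereal_sup_max => [|a _]; [exists i0 | exact: leey].
  exact: leey.
have /choice[k kE] i : exists k, dim i = k%:R%:E /\ exists G : lmodType (quotr (x i)),
    fin_gen G /\ forall M, over_quotr (x i) (MF (x i)) M <-> bracketS (sing G) k M.
  case: (ereal_inf_nat [set n : nat | exists G : lmodType (quotr (x i)), fin_gen G /\
      forall M, over_quotr (x i) (MF (x i)) M <-> bracketS (sing G) n M]).
    by case=> dimy _; case: fin; exists i.
  by case=> m [e Gm _]; exists m.
pose i0 := [arg max_(i > ord0) k i]%N; pose d := k i0.
have kd i : (k i <= d)%N by rewrite /d /i0; case: arg_maxnP => // j _; exact.
have -> : ereal_sup (range dim) = d%:R%:E.
  apply: ereal_sup_max; first by exists i0; rewrite // (kE i0).1.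
  by move=> _ [i _ <-]; rewrite (kE i).1 lee_fin ler_nat.
have mfd i : mf_built (x i) d.
  have [_ [G [_ hG]]] := kE i.
  have [a [b [A [B [AB bMF]]]]] := MF_built (hx i) hG.
  by exists a, b, A, B; split=> // N /bMF; exact: built_le.
have [G [fG kG bG]] := bigstar_built hx mfd.
(* [bracketS] at index [d.+1] is [G]_(d+2), which bounds the radius by d + 1. *)
have hGd : exists G : lmodType (quotr (\prod_i x i)),
    fin_gen G /\ forall M, over_quotr (\prod_i x i) (bigstar (fun i => MF (x i))) M ->
      bracketS (sing G) d.+1 M.
  exists (quotr_mod kG); split; first exact: quotr_mod_fin_gen.
  move=> M /bG bM; have hM := restr_killed (M := M).
  apply: bracketS_retract (built_bracketS kG hM bM).
  exact/isom_retract/quotr_mod_restr.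
rewrite /subcat_radius; set gens := (X in image X _).
have [[_ /(_ d.+1)/(_ hGd) //]|[m [-> _ /(_ d.+1 hGd) md]]] := ereal_inf_nat gens.
by rewrite -EFinD lee_fin natr1 ler_nat.
Qed.
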